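(* Let $\mathfrak g$ be a complex classical simple Lie algebra and let $\mathfrak n$ be the nilradical of a minimal parabolic subalgebra of the split real form of $\mathfrak g$. Let $s\ge 0$ be an integer such that $\mathbb R^s\oplus\mathfrak n$ has even dimension. Then $\mathbb R^s\oplus\mathfrak n$ admits symplectic structures if and only if $\mathfrak g$ is (isomorphic to) one of $$\mathfrak{sl}(2,\mathbb C),\qquad \mathfrak{sl}(3,\mathbb C),\qquad \mathfrak{so}(5,\mathbb C).$$
   Context: The complex classical simple Lie algebras are, up to isomorphism, $\mathfrak{sl}(n+1,\mathbb C)$ ($n\ge1$), $\mathfrak{so}(2n+1,\mathbb C)$ ($n\ge2$), $\mathfrak{sp}(2n,\mathbb C)$ ($n\ge3$; rank $n$), $\mathfrak{so}(2n,\mathbb C)$ ($n\ge4$). Given a complex semisimple Lie algebra $\mathfrak g$ with a Cartan subalgebra and a choice of positive roots $\triangle^+$, the complex nilpotent Lie algebra $\bigoplus_{\alpha\in\triangle^+}\mathfrak g_\alpha$ has a basis $\{X_\alpha\}_{\alpha\in\triangle^+}$ with $\mathfrak g_\alpha=\mathbb C X_\alpha$ and real structure constants (e.g. from a Chevalley basis). The real nilpotent Lie algebra $\mathfrak n$ with basis $\{X_\alpha\}_{\alpha\in\triangle^+}$ and these structure constants is the nilradical of the minimal parabolic subalgebra of the split real form of $\mathfrak g$; up to isomorphism it depends only on $\mathfrak g$. $\mathbb R^s\oplus\mathfrak n$ is the direct sum of $\mathfrak n$ with the abelian Lie algebra $\mathbb R^s$. A symplectic structure on a real Lie algebra $\mathfrak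 a$ is a non-degenerate skew-symmetric bilinear form $\omega$ on $\mathfrak a$ that is closed for the Chevalley–Eilenberg differential, i.e. $\omega([x,y],w)+\omega([y,w],x)+\omega([w,x],y)=0$ for all $x,y,w\in\mathfrak a$. *)

(* Defs.v *)
From HB Require Import structures.
From mathcomp Require Import all_boot all_order all_algebra.
From mathcomp Require Import finmap.
From mathcomp Require Import ring.
From mathcomp Require Import reals.
From mathcomp.real_closed Require Import complex.

Set Implicit Arguments.
Unset Strict Implicit.
Unset Printing Implicit Defensive.

Import GRing.Theory.
Local Open Scope ring_scope.

Record lieAlg (K : fieldType) := LieAlg {
  lie_sort :> vectType K;
  lie_br : lie_sort -> lie_sort -> lie_sort;
  lie_bilinear : bilinear_for *:%R *:%R lie_br;
  lie_alt : forall x, lie_br x x = 0;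
  lie_jacobi : forall x y z,
    lie_br x (lie_br y z) + lie_br y (lie_br z x) + lie_br z (lie_br x y) = 0 }.

Arguments lie_br {K l} x y.
Arguments LieAlg {K} lie_sort lie_br _ _ _.

Definition lie_iso (K : fieldType) (g1 g2 : lieAlg K) : Prop :=
  exists f : {linear g1 -> g2},
    bijective f /\ forall x y, f (lie_br x y) = lie_br (f x) (f y).

Section Constructions.
Variable K : fieldType.

Section Abelian.
Variable s : nat.

Definition abelian_br (x y : 'rV[K]_s) : 'rV[K]_s := 0.

Fact abelian_bilinear : bilinear_for *:%R *:%R abelian_br.
Proof. by split=> u a v w; rewrite /abelian_br /= /abelian_br scaler0 addr0. Qed.

Fact abelian_alt x : abelian_br x x = 0. Proof. by []. Qed.

Fact abelian_jacobi x y z :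
  abelian_br x (abelian_br y z) + abelian_br y (abelian_br z x)
    + abelian_br z (abelian_br x y) = 0.
Proof. by rewrite /abelian_br !addr0. Qed.

Definition abelian_lie : lieAlg K :=
  LieAlg 'rV[K]_s abelian_br abelian_bilinear abelian_alt abelian_jacobi.
End Abelian.

Section DirectSum.
Variables a b : lieAlg K.

Definition dsum_br (x y : (a * b)%type) : (a * b)%type :=
  (lie_br x.1 y.1, lie_br x.2 y.2).

Fact dsum_bilinear : bilinear_for *:%R *:%R dsum_br.
Proof.
have [la ra] := lie_bilinear a; have [lb rb] := lie_bilinear b.
split=> u c v w; rewrite /dsum_br /= /dsum_br.
- by congr pair; [apply: la | apply: lb].
- by congr pair; [apply: ra | apply: rb].
Qed.

Fact dsum_alt x : dsum_br x x = 0.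
Proof. by rewrite /dsum_br !lie_alt. Qed.

Fact dsum_jacobi x y z :
  dsum_br x (dsum_br y z) + dsum_br y (dsum_br z x) + dsum_br z (dsum_br x y) = 0.
Proof. by congr pair; apply: lie_jacobi. Qed.

Definition dsum_lie : lieAlg K :=
  LieAlg (a * b)%type dsum_br dsum_bilinear dsum_alt dsum_jacobi.
End DirectSum.

Section Subalgebra.
Variables (g : lieAlg K) (U : {vspace g}).
Hypothesis U_br : forall x y, x \in U -> y \in U -> lie_br x y \in U.

Definition sub_br (x y : subvs_of U) : subvs_of U :=
  Subvs (U_br (valP x) (valP y)).

Fact sub_bilinear : bilinear_for *:%R *:%R sub_br.
Proof.
have [lg rg] := lie_bilinear g.
by split=> u c v w; apply: val_inj; [apply: lg | apply: rg].
Qed.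

Fact sub_alt x : sub_br x x = 0.
Proof. by apply: val_inj; rewrite /= lie_alt. Qed.

Fact sub_jacobi x y z :
  sub_br x (sub_br y z) + sub_br y (sub_br z x) + sub_br z (sub_br x y) = 0.
Proof. by apply: val_inj; apply: lie_jacobi. Qed.

Definition sub_lie : lieAlg K :=
  LieAlg (subvs_of U) sub_br sub_bilinear sub_alt sub_jacobi.
End Subalgebra.

Section General.
Variable m : nat.

Definition gl_br (A B : 'M[K]_m) : 'M[K]_m := A *m B - B *m A.

Fact gl_bilinear : bilinear_for *:%R *:%R gl_br.
Proof.
split=> u c v w; rewrite /gl_br /= /gl_br.
- by rewrite mulmxDl mulmxDr -scalemxAl -scalemxAr opprD addrACA -scalerBr.
- by rewrite mulmxDl mulmxDr -scalemxAl -scalemxAr opprD addrACA -scalerBr.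
Qed.

Fact gl_alt A : gl_br A A = 0. Proof. exact: subrr. Qed.

Fact gl_jacobi A B C :
  gl_br A (gl_br B C) + gl_br B (gl_br C A) + gl_br C (gl_br A B) = 0.
Proof.
rewrite /gl_br !mulmxBr !mulmxBl !mulmxA.
by apply/matrixP=> i j; rewrite !mxE; ring.
Qed.

Definition gl_lie : lieAlg K :=
  LieAlg 'M[K]_m gl_br gl_bilinear gl_alt gl_jacobi.

Definition sl_space : {vspace gl_lie} :=
  lker (linfun (fun A : 'M[K]_m => \tr A : K^o)).

Fact sl_spaceE (A : 'M[K]_m) : (A \in sl_space) = (\tr A == 0).
Proof. by rewrite memv_ker lfunE. Qed.

Fact sl_space_br (A B : gl_lie) :
  A \in sl_space -> B \in sl_space -> lie_br A B \in sl_space.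
Proof.
by move=> _ _; rewrite sl_spaceE /= /gl_br raddfB /= mxtrace_mulC subrr.
Qed.

Definition sl_lie : lieAlg K := sub_lie sl_space_br.

(* Infinitesimal isometries of the bilinear form with Gram matrix [J]. *)
Section Isometries.
Variable J : 'M[K]_m.

Definition isom_cond (A : 'M[K]_m) : 'M[K]_m := A^T *m J + J *m A.

Fact isom_cond_linear : linear isom_cond.
Proof.
move=> u A B; rewrite /isom_cond linearP /= mulmxDl mulmxDr.
by rewrite -scalemxAl -scalemxAr addrACA -scalerDr.
Qed.

HB.instance Definition _ :=
  GRing.isLinear.Build K 'M[K]_m 'M[K]_m *:%R isom_cond isom_cond_linear.

Definition isom_space : {vspace gl_lie} := lker (linfun isom_cond).

Fact isom_spaceE (A : 'M[K]_m) :
  (A \in isom_space) = (A^T *m J + J *m A == 0).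
Proof. by rewrite memv_ker lfunE. Qed.

Fact isom_space_br (A B : gl_lie) :
  A \in isom_space -> B \in isom_space -> lie_br A B \in isom_space.
Proof.
rewrite !isom_spaceE /= /gl_br !addr_eq0 => /eqP hA /eqP hB.
rewrite linearB /= !trmx_mul mulmxBl mulmxBr -!mulmxA hA hB.
rewrite !mulmxN !mulmxA hA hB !mulNmx -!mulmxA.
by apply/eqP; rewrite !opprK opprB.
Qed.

Definition isom_lie : lieAlg K := sub_lie isom_space_br.
End Isometries.
End General.

Definition so_lie (m : nat) : lieAlg K := isom_lie (1%:M : 'M[K]_m).

Definition sp_lie (n : nat) : lieAlg K :=
  isom_lie (block_mx 0 1%:M (- 1%:M) 0 : 'M[K]_(n + n)).

End Constructions.

Definition classical_simple (R : realType) (g : lieAlg R[i]) : Prop :=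
  [\/ exists2 n : nat, (1 <= n)%N & lie_iso g (sl_lie R[i] n.+1),
      exists2 n : nat, (2 <= n)%N & lie_iso g (so_lie R[i] (2 * n).+1),
      exists2 n : nat, (3 <= n)%N & lie_iso g (sp_lie R[i] n)
    | exists2 n : nat, (4 <= n)%N & lie_iso g (so_lie R[i] (2 * n))].

Section Roots.
Variables (K : fieldType) (g : lieAlg K).

Definition lie_abelian (h : {vspace g}) : Prop :=
  {in h &, forall x y : g, lie_br x y = 0}.

Definition lfun_diagonalizable (f : g -> g) : Prop :=
  exists2 e : seq g, basis_of {:g} e &
    {in e, forall v, exists a : K, f v = a *: v}.

(* Over an algebraically closed field and for semisimple [g], a Cartan
   subalgebra is a maximal abelian subalgebra all of whose elements are
   ad-semisimple, that is, ad-diagonalizable. *)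
Definition is_cartan (h : {vspace g}) : Prop :=
  [/\ lie_abelian h,
      forall k : {vspace g}, lie_abelian k -> (h <= k)%VS -> k = h &
      {in h, forall x, lfun_diagonalizable (lie_br x)}].

Variable h : {vspace g}.

Definition dual_space := 'Hom(subvs_of h, K^o).

Definition in_root_space (a : dual_space) (x : g) : Prop :=
  forall t : subvs_of h, lie_br (vsval t) x = a t *: x.

Definition is_root (a : dual_space) : Prop :=
  a != 0 /\ exists2 x : g, x != 0 & in_root_space a x.

Definition is_positive_system (D : {fset dual_space}) : Prop :=
  [/\ forall a, a \in D -> is_root a,
      forall a, is_root a -> (a \in D) (+) (- a \in D) &
      forall a b, a \in D -> b \in D -> is_root (a + b) -> a + b \in D].

End Roots.

(* [n] has a basis [x] indexed by the positive roots whose structure constants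
   [c] are those of a basis [X] of root vectors of [g]; the type of [c] forces
   these constants to be real. *)
Definition is_real_nilradical (R : realType) (g : lieAlg R[i]) (n : lieAlg R) :
    Prop :=
  exists (h : {vspace g}) (D : {fset dual_space h}) (X : D -> g)
         (c : D -> D -> D -> R) (x : D -> n),
    [/\ is_cartan h,
        is_positive_system D,
        forall (a : D) (y : g),
          in_root_space (val a) y <-> y \in <[X a]>%VS,
        forall a b : D,
          lie_br (X a) (X b) = \sum_(d : D) (c a b d)%:C%C *: X d &
        basis_of {:n} (codom x) /\
        forall a b : D, lie_br (x a) (x b) = \sum_(d : D) c a b d *: x d].

(* [{skew_symmetric a}] is the type of skew-symmetric bilinear forms on [a];
   [nondegenerate w] says that the radical of [w] is zero. *)
Definition has_symplectic (K : fieldType) (a : lieAlg K) : Prop :=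
  exists2 w : {skew_symmetric a},
    nondegenerate w &
    forall x y z,
      w (lie_br x y) z + w (lie_br y z) x + w (lie_br z x) y = 0.

(* Main.v *)
Require Import Defs.
From HB Require Import structures.
From mathcomp Require Import all_boot all_order all_algebra.
From mathcomp Require Import finmap.
From mathcomp Require Import ring zify.
From mathcomp Require Import boolp reals.
From mathcomp.real_closed Require Import complex.

(** For a classical simple [g] both sides are equivalent to [dim g <= 10].

    If [dim g <= 10], then [2 |D| + 1 <= dim g] forces [|D| <= 4]. A nilpotent
    algebra graded by so few positive roots has a symplectic form which pairs
    basis vectors so that each decomposable root [k + l] is matched with [k]
    or [l]; this matching condition makes the form closed.

    If [dim g > 10], then every non-zero [ad x] has rank at least 5. Let [q] be a
    positive root whose root vector [X q] is central in the nilradical, and let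
    [L] be the set of [d] in [D] with [q - d] in [D], that is, of height 1 for the
    sl2-triple of [q]. As [X q] has an adjoint image of dimension at most
    [2 + |L|], there are at least 3 elements in [L]. Then [X q] lies in the radical
    of every closed form [w]. If [al] is in [L], write [X q] as a bracket of two
    root vectors of [L] commuting with [X al]. If [al] is not in [L], sum the
    closedness relations for [d], [q - d], [al] over [d] in [L], each divided by
    the structure constant of [d] and [q - d]: the terms other than
    [w (X q) (X al)] cancel along the involution [d |-> q - al - d]. *)

Set Implicit Arguments.
Unset Strict Implicit.
Unset Printing Implicit Defensive.

Import Order.TTheory GRing.Theory Num.Theory.
Local Open Scope ring_scope.

(** * Bilinear calculus of the Lie bracket *)

Section LieBracket.
Variables (K : fieldType) (g : lieAlg K).
Implicit Types x y z : g.

Fact lie_br_is_linear x : linear (lie_br x).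
Proof. by have [_ r] := lie_bilinear g; apply: r. Qed.

HB.instance Definition _ x :=
  GRing.isLinear.Build K g g *:%R (lie_br x) (lie_br_is_linear x).

Lemma lie_brC x y : lie_br x y = - lie_br y x.
Proof.
have [l _] := lie_bilinear g.
have ladd (a b c : g) : lie_br (a + b) c = lie_br a c + lie_br b c.
  by have /= := l c 1 a b; rewrite !scale1r.
apply/eqP; rewrite -addr_eq0; apply/eqP.
have := lie_alt (x + y); rewrite raddfD /= !ladd !lie_alt add0r addr0.
by rewrite addrC.
Qed.

Lemma lie_br0r x : lie_br x 0 = 0. Proof. exact: raddf0. Qed.
Lemma lie_brDr x y z : lie_br x (y + z) = lie_br x y + lie_br x z.
Proof. exact: raddfD. Qed.
Lemma lie_brNr x y : lie_br x (- y) = - lie_br x y. Proof. exact: raddfN. Qed.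
Lemma lie_brZr a x y : lie_br x (a *: y) = a *: lie_br x y.
Proof. exact: linearZ. Qed.
Lemma lie_br_sumr (I : Type) (r : seq I) (P : pred I) x (F : I -> g) :
  lie_br x (\sum_(i <- r | P i) F i) = \sum_(i <- r | P i) lie_br x (F i).
Proof. exact: raddf_sum. Qed.

Lemma lie_br0l x : lie_br 0 x = 0. Proof. by rewrite lie_brC lie_br0r oppr0. Qed.
Lemma lie_brDl x y z : lie_br (x + y) z = lie_br x z + lie_br y z.
Proof. by rewrite lie_brC lie_brDr opprD -!lie_brC. Qed.
Lemma lie_brZl a x y : lie_br (a *: x) y = a *: lie_br x y.
Proof. by rewrite lie_brC lie_brZr -scalerN -lie_brC. Qed.
Lemma lie_br_suml (I : Type) (r : seq I) (P : pred I) (F : I -> g) x :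
  lie_br (\sum_(i <- r | P i) F i) x = \sum_(i <- r | P i) lie_br (F i) x.
Proof. by rewrite lie_brC lie_br_sumr -sumrN; apply: eq_bigr => i _; rewrite -lie_brC. Qed.

Lemma lie_jacobi_der x y z :
  lie_br x (lie_br y z) = lie_br (lie_br x y) z + lie_br y (lie_br x z).
Proof.
apply/eqP; rewrite -subr_eq0 -(lie_jacobi x y z) -addrA; apply/eqP; congr (_ + _).
by rewrite opprD addrC (lie_brC z x) lie_brNr (lie_brC z).
Qed.

End LieBracket.


(** * Independence of simultaneous eigenvectors *)

Section WeightVectors.
Variables (K : fieldType) (V : lmodType K) (T : Type) (op : T -> V -> V).
Hypothesis op_linear : forall t, linear (op t).

(** Applying [op t] to the relation and subtracting [w i0 t] times it removes the [i0] term and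
    rescales every other term by [w i t - w i0 t]; induction on [s] concludes. The family [op]
    serves both for the adjoint action of [h] and for a single operator indexed by [unit]. *)
Lemma weight_vectors_free (I : eqType) (s : seq I) (w : I -> T -> K) (x : I -> V) :
  uniq s ->
  (forall i t, i \in s -> op t (x i) = w i t *: x i) ->
  {in s &, forall i j, i != j -> exists t, w i t != w j t} ->
  \sum_(i <- s) x i = 0 -> {in s, forall i, x i = 0}.
Proof.
pose f t : {linear V -> V} :=
  HB.pack (op t) (GRing.isLinear.Build K V V *:%R (op t) (op_linear t)).
elim: s x => // i0 s IH x /= /andP [i0s us] hx hw; rewrite big_cons => sum0.
have xs0 j : j \in s -> x j = 0.
  move=> js; have ij : i0 != j by apply: contraNneq i0s => ->.
  have [t wt] : exists t, w i0 t != w j t.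
    by apply: hw => //; rewrite inE ?eqxx ?js ?orbT.
  have : (w j t - w i0 t) *: x j = 0.
    apply: (IH (fun i => (w i t - w i0 t) *: x i)) => //.
    - move=> i t' si; rewrite -[op t']/(f t' : _ -> _) linearZ /=.
      by rewrite hx ?inE ?si ?orbT // !scalerA mulrC.
    - by move=> a b sa sb; apply: hw; rewrite inE ?sa ?sb orbT.
    - have := congr1 (f t) sum0; rewrite raddf0 raddfD raddf_sum /= hx ?mem_head //.
      have -> : \sum_(i <- s) op t (x i) = \sum_(i <- s) w i t *: x i.
        by apply: eq_big_seq => i si; rewrite hx // inE si orbT.
      move=> e.
      have {}e : \sum_(i <- s) w i t *: x i = - (w i0 t *: x i0).
        by apply/eqP; rewrite -addr_eq0 addrC e.
      have {}sum0 : \sum_(i <- s) x i = - x i0.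
        by apply/eqP; rewrite -addr_eq0 addrC sum0.
      under eq_bigr do rewrite scalerBl.
      by rewrite sumrB -scaler_sumr e sum0 scalerN subrr.
  by move/eqP; rewrite scaler_eq0 subr_eq0 eq_sym (negbTE wt) => /eqP.
move=> i; rewrite inE => /predU1P [->|]; last exact: xs0.
by rewrite big1_seq ?addr0 // in sum0.
Qed.

End WeightVectors.

(** * Weight decomposition for a Cartan subalgebra *)

(** Spanning by a predicate that is not closed under addition. Weight decompositions stated this way
    need no list of the occurring weights. *)
Definition sum_of (V : zmodType) (P : V -> Prop) (x : V) : Prop :=
  exists s : seq V, x = \sum_(y <- s) y /\ {in s, forall y, P y}.

Section SumOf.
Variable V : zmodType.
Implicit Types (P Q : V -> Prop) (x y : V).

Lemma sum_of1 P x : P x -> sum_of P x.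
Proof.
by move=> Px; exists [:: x]; rewrite big_seq1; split=> // y /[1!inE] /eqP ->.
Qed.

Lemma sum_of_sum P (s : seq V) :
  {in s, forall y, sum_of P y} -> sum_of P (\sum_(y <- s) y).
Proof.
elim: s => [|x s IH] hs; first by exists [::]; rewrite !big_nil.
have [s1 [xE P1]] := hs x (mem_head _ _).
have [|s2 [sE P2]] := IH; first by move=> y ys; apply: hs; rewrite inE ys orbT.
rewrite big_cons xE sE; exists (s1 ++ s2); rewrite big_cat; split=> // y.
by rewrite mem_cat => /orP [/P1|/P2].
Qed.

Lemma sum_of_trans P Q x :
  sum_of P x -> (forall y, P y -> sum_of Q y) -> sum_of Q x.
Proof. by move=> [s [-> Ps]] PQ; apply: sum_of_sum => y /Ps /PQ. Qed.

End SumOf.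

(* The last clause says that the eigencomponents of a vector inherit every
   eigenvector equation for an operator commuting with [f]. *)
Lemma eigen_decomposition (K : fieldType) (g : lieAlg K) (f : {linear g -> g}) (y : g) :
  lfun_diagonalizable f ->
  sum_of (fun z => (exists a : K, f z = a *: z) /\
    forall (E : {linear g -> g}) (mu : K), (forall u, E (f u) = f (E u)) ->
      E y = mu *: y -> E z = mu *: z) y.
Proof.
move=> [e ebasis /(_ _ _) he].
have /choice [lam lamP] : forall v, exists a : K, v \in e -> f v = a *: v.
  move=> v; have [ve|] := boolP (v \in e); last by exists 0.
  by have [a fa] := he _ ve; exists a.
have ye : y \in <<in_tuple e>>%VS by rewrite (span_basis ebasis) memvf.
pose F (i : 'I_(size e)) := coord (in_tuple e) i y *: e`_i.
pose L := undup [seq lam v | v <- e].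
pose c (l : K) : g := \sum_(i < size e | lam e`_i == l) F i.
have fF i : f (F i) = lam e`_i *: F i.
  by rewrite /F linearZ /= lamP ?mem_nth // !scalerA mulrC.
have fc l : f (c l) = l *: c l.
  rewrite /c raddf_sum scaler_sumr; apply: eq_bigr => i /eqP <-; exact: fF.
have yE : y = \sum_(l <- L) c l.
  rewrite [LHS](coord_span ye) /c (exchange_big_dep xpredT) //=.
  apply: eq_bigr => i _; rewrite big_mkcond (bigD1_seq (lam e`_i)) ?undup_uniq //=.
    by rewrite eqxx big1 ?addr0 // => l /negbTE; rewrite eq_sym => ->.
  by rewrite mem_undup map_f ?mem_nth.
exists [seq c l | l <- L]; rewrite big_map; split=> // _ /mapP [l lL ->].
split=> [|E mu Ef Ey]; first by exists l.
apply/eqP; rewrite -subr_eq0; apply/eqP.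
pose op (_ : unit) : g -> g := f.
have op_lin t : linear (op t) by move=> a u v; rewrite /op linearP.
(* The vectors [E (c l) - mu *: c l] are eigenvectors of [f] for the distinct values [l], because
   [E] commutes with [f], and they add up to zero; hence each vanishes. *)
apply: (@weight_vectors_free _ _ _ op op_lin _ L (fun l _ => l)
  (fun l => E (c l) - mu *: c l)) => //.
- exact: undup_uniq.
- move=> i [] _; rewrite /op /= raddfB /= -Ef fc !linearZ /= fc.
  by rewrite scalerDr !scalerN !scalerA mulrC.
have {}Ey : \sum_(l <- L) E (c l) = mu *: y by rewrite -Ey [in RHS]yE raddf_sum.
by rewrite sumrB -scaler_sumr -yE Ey subrr.
Qed.

Section Cartan.
Variables (K : fieldType) (g : lieAlg K) (h : {vspace g}).
Hypothesis h_cartan : is_cartan h.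
Local Notation wt := (@in_root_space K g h).
Implicit Types (a b : dual_space h) (x y z : g).

Lemma wt_br a b x y : wt a x -> wt b y -> wt (a + b) (lie_br x y).
Proof.
move=> ha hb t; rewrite lie_jacobi_der ha hb lie_brZl lie_brZr -scalerDl.
by rewrite add_lfunE.
Qed.

Lemma wtZ a c x : wt a x -> wt a (c *: x).
Proof. by move=> ha t; rewrite lie_brZr ha !scalerA mulrC. Qed.

Lemma wtB a x y : wt a x -> wt a y -> wt a (x - y).
Proof. by move=> hx hy t; rewrite raddfB /= hx hy scalerBr. Qed.

Lemma wt_cartan (t : subvs_of h) : wt 0 (vsval t).
Proof.
have [ab _ _] := h_cartan.
by move=> t'; rewrite zero_lfunE scale0r ab ?subvsP.
Qed.

(** A vector of weight zero commutes with [h], so [h + <[x]>] is still abelian and maximality gives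
    [x \in h]. *)
Lemma wt0_cartan x : wt 0 x -> x \in h.
Proof.
have [ab hmax _] := h_cartan => hx.
have hx0 (t : g) : t \in h -> lie_br t x = 0.
  by move=> th; have := hx (Subvs th); rewrite zero_lfunE scale0r.
rewrite -(hmax (h + <[x]>)%VS); first by rewrite memvE addvSr.
  move=> u v /memv_addP [u1 hu1 [_ /vlineP [c ->] ->]].
  move=> /memv_addP [v1 hv1 [_ /vlineP [d ->] ->]].
  rewrite lie_brDl !lie_brDr !lie_brZl !lie_brZr ab // hx0 // lie_alt.
  by rewrite lie_brC hx0 // oppr0 !scaler0 !addr0.
exact: addvSl.
Qed.

Lemma weight_free (I : eqType) (s : seq I) (w : I -> dual_space h) (x : I -> g) :
  uniq s -> {in s &, injective w} -> {in s, forall i, wt (w i) (x i)} ->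
  \sum_(i <- s) x i = 0 -> {in s, forall i, x i = 0}.
Proof.
move=> us winj hx sum0.
pose op (t : subvs_of h) : g -> g := lie_br (vsval t).
have op_lin t : linear (op t) by move=> c u v; rewrite /op linearP.
apply: (@weight_vectors_free _ _ _ op op_lin _ s (fun i t => w i t) x) => //.
  by move=> i t si; apply: hx.
move=> i j si sj ij; apply: contrapT => wij; case/negP: ij; apply/eqP.
apply: winj => //; apply/lfunP => t; apply: contrapT => wt.
by apply: wij; exists t; apply/eqP.
Qed.

(** Simultaneous diagonalization: the components are refined one element of a basis of [h] at a
    time. Earlier eigenvector equations survive each refinement since [h] is abelian. *)
Lemma weight_decomposition x : sum_of (fun y => exists a, wt a y) x.
Proof.
have [ab _ diag] := h_cartan.
have dec (ts : seq g) : {subset ts <= h} -> forall z,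
    sum_of (fun y => {in ts, forall t, exists c : K, lie_br t y = c *: y}) z.
  elim: ts => [|t ts IH] tsh z; first exact: sum_of1.
  have [|s [zE hs]] := IH _ z; first by move=> u uts; apply: tsh; rewrite inE uts orbT.
  have th : t \in h by apply: tsh; rewrite mem_head.
  rewrite zE; apply: sum_of_sum => y /hs hy.
  apply: sum_of_trans (eigen_decomposition y (diag t th)) _.
  move=> u [hu1 hu2]; apply: sum_of1 => t' /predU1P [->//|t'ts].
  have [c hc] := hy _ t'ts; exists c; apply: (hu2 (lie_br t')) => // v.
  have t'h : t' \in h by apply: tsh; apply: mem_behead.
  by rewrite /= lie_jacobi_der (ab t' t) // lie_br0l add0r.
apply: sum_of_trans (dec (vbasis h) _ x) _; first by move=> t; apply: vbasis_mem.
move=> y hy; apply: sum_of1.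
have /choice [c cP] : forall t, exists c : K, t \in vbasis h -> lie_br t y = c *: y.
  move=> t; have [tb|] := boolP (t \in vbasis h); last by exists 0.
  by have [c hc] := hy _ tb; exists c.
(* The weight is the linear functional on [h] whose values on the basis are the eigenvalues. *)
exists (\sum_(i < \dim h) c (vbasis h)`_i *:
  linfun (coord (vbasis h) i \o @vsval _ _ h : subvs_of h -> K^o)) => t.
rewrite {1}(coord_vbasis (subvsP t)) lie_br_suml sum_lfunE scaler_suml.
apply: eq_bigr => i _; rewrite lie_brZl cP ?mem_nth ?size_tuple //.
by rewrite scalerA scale_lfunE lfunE /= [X in X *: _ = _]mulrC.
Qed.

End Cartan.

(** * Positive roots and the highest root *)

(** A stand-in for the Killing form; for the matrix algebras it is instantiated by the trace form of
    the defining representation. Linearity in the first argument follows by symmetry. *)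
Definition invariant_form (K : fieldType) (g : lieAlg K) (B : g -> g -> K^o) : Prop :=
  [/\ forall x, linear (B x),
      forall x y, B x y = B y x,
      forall x y z, B (lie_br x y) z = B x (lie_br y z) &
      forall x, x != 0 -> exists y, B x y != 0].

Section RootSystem.
Variables (K : numFieldType) (g : lieAlg K) (h : {vspace g}).
Variables (D : {fset dual_space h}) (X : D -> g) (B : g -> g -> K^o).
Hypothesis h_cartan : is_cartan h.
Hypothesis D_pos : is_positive_system D.
Hypothesis X_span : forall (a : D) (y : g), in_root_space (val a) y <-> y \in <[X a]>%VS.
Hypothesis B_inv : invariant_form B.
Local Notation wt := (@in_root_space K g h).
Implicit Types (a b : dual_space h) (d e : D) (x y z : g).

Lemma B0r x : B x 0 = 0.
Proof.
have [l _ _ _] := B_inv; have := l x (-1) 0 0.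
by rewrite scaler0 addr0 scaleN1r addNr.
Qed.

Lemma BDr x y z : B x (y + z) = B x y + B x z.
Proof. by have [l _ _ _] := B_inv; rewrite -[y in LHS]scale1r l scale1r. Qed.

Lemma BZr c x y : B x (c *: y) = c * B x y.
Proof. by have [l _ _ _] := B_inv; rewrite -[_ *: y]addr0 l B0r addr0. Qed.

Lemma BC x y : B x y = B y x. Proof. by have [] := B_inv. Qed.

Lemma B_br x y z : B (lie_br x y) z = B x (lie_br y z).
Proof. by have [] := B_inv. Qed.

Lemma BZl c x y : B (c *: x) y = c * B x y.
Proof. by rewrite BC BZr BC. Qed.

Lemma B_sum_of (P : g -> Prop) x y :
  sum_of P y -> (forall z, P z -> B x z = 0) -> B x y = 0.
Proof.
move=> [s [-> Ps]] h0; elim: s Ps => [|z s IH] Ps; first by rewrite big_nil B0r.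
rewrite big_cons BDr (h0 z) ?add0r; last exact: Ps (mem_head _ _).
by apply: IH => u us; apply: Ps; rewrite inE us orbT.
Qed.

(** Moving [t] across the invariant form gives [(a + b) t * B x y = 0] for every [t] in [h]. *)
Lemma B_orth a b x y : wt a x -> wt b y -> a + b != 0 -> B x y = 0.
Proof.
move=> hx hy ab; have /lfunPn [t] : a + b != 0 by [].
rewrite zero_lfunE add_lfunE => abt.
have e : B (lie_br (vsval t) x) y = - B x (lie_br (vsval t) y).
  by rewrite lie_brC -[- _]scaleN1r BZl B_br mulN1r.
move/eqP: e; rewrite hx hy BZl BZr -addr_eq0 -mulrDl mulf_eq0 (negbTE abt).
by move/eqP.
Qed.

Lemma X_wt d : wt (val d) (X d). Proof. by apply/X_span; apply: memv_line. Qed.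

Lemma X_line d y : wt (val d) y -> exists c, y = c *: X d.
Proof. by move=> /X_span /vlineP. Qed.

Lemma D_root d : is_root (val d). Proof. by have [r _ _] := D_pos; apply/r/valP. Qed.

Lemma D_neq0 d : val d != 0. Proof. by have [] := D_root d. Qed.

Lemma X_neq0 d : X d != 0.
Proof.
have [_ [x x0 /X_span /vlineP [c xE]]] := D_root d.
by apply: contraNneq x0 => X0; rewrite xE X0 scaler0.
Qed.

Lemma D_opp d e : val d != - val e.
Proof.
have [_ /(_ _ (D_root e)) xor _] := D_pos.
apply: contraTneq xor => de; move: (valP d); rewrite de => ->.
by rewrite (valP e).
Qed.

Lemma wt_root c z : wt c z -> z != 0 -> c != 0 ->
  (exists d, val d = c) \/ (exists d, val d = - c).
Proof.
move=> hz z0 c0; have [_ /(_ c) xor _] := D_pos.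
have /xor : is_root c by split=> //; exists z.
have [cD _|_ /= cD] := boolP (c \in D); first by left; exists (FSetSub cD).
by right; exists (FSetSub cD).
Qed.

Lemma D_add d e : lie_br (X d) (X e) != 0 -> exists f : D, val f = val d + val e.
Proof.
move=> br0; have de0 : val d + val e != 0 by rewrite addr_eq0 D_opp.
have [_ _ /(_ _ _ (valP d) (valP e)) add] := D_pos.
have /add deD : is_root (val d + val e).
  by split=> //; exists (lie_br (X d) (X e)) => //; apply: wt_br; apply: X_wt.
by exists (FSetSub deD).
Qed.

(** By non-degeneracy [z] pairs with some vector. Only its component of weight [val d] can
    contribute, and that component is a multiple of [X d]. *)
Lemma X_pairing d z : wt (- val d) z -> z != 0 -> B z (X d) != 0.
Proof.
move=> hz z0; have [_ _ _ /(_ z z0) [y]] := B_inv; apply: contraNneq => zX; apply/eqP.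
apply: (B_sum_of (weight_decomposition h_cartan y)) => u [a hu].
have [ad|ad] := eqVneq a (val d).
  by rewrite ad in hu; have [c ->] := X_line hu; rewrite BZr zX mulr0.
by apply: B_orth hz hu _; rewrite addrC subr_eq0.
Qed.

Lemma opposite_root_vector d : exists2 y, wt (- val d) y & B (X d) y != 0.
Proof.
have [_ _ _ /(_ _ (X_neq0 d)) [y]] := B_inv => By.
apply: contrapT => no; case/negP: By; apply/eqP.
apply: (B_sum_of (weight_decomposition h_cartan y)) => u [a hu].
have [ad|ad] := eqVneq a (- val d); last first.
  by apply: B_orth (X_wt d) hu _; rewrite addrC addr_eq0.
rewrite ad in hu; apply/eqP; apply: contrapT => /negP Bu.
by apply: no; exists u.
Qed.

Lemma dualMn b n (t : subvs_of h) : (b *+ n) t = b t *+ n.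
Proof.
by elim: n => [|n IH]; rewrite ?mulr0n ?zero_lfunE // !mulrS add_lfunE IH.
Qed.

Lemma wt_iter a b y z k : wt b y -> wt a z -> wt (a + b *+ k) (iter k (lie_br y) z).
Proof.
move=> hy hz; elim: k => [|k IH]; first by rewrite mulr0n addr0.
by rewrite mulrS addrCA iterS; apply: wt_br.
Qed.

Lemma weight_vectors_dim (I : finType) (w : I -> dual_space h) (x : I -> g) :
  injective w -> (forall i, wt (w i) (x i)) -> (forall i, x i != 0) ->
  (#|I| <= \dim {:g})%N.
Proof.
move=> winj hx x0; pose v := mktuple (fun j : 'I_#|I| => x (enum_val j)).
have vE (j : 'I_#|I|) : v`_j = x (enum_val j).
  by rewrite (nth_map j) ?size_enum_ord // nth_ord_enum.
have fv : free v.
  apply/freeP => k sum0 j.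
  have /eqP : k j *: x (enum_val j) = 0.
    apply: (weight_free (s := index_enum 'I_#|I|) (w := fun j => w (enum_val j))
      (x := fun j => k j *: x (enum_val j))).
    - exact: index_enum_uniq.
    - by move=> j1 j2 _ _ /winj /enum_val_inj.
    - by move=> i _; apply: wtZ.
    - by rewrite -[RHS]sum0; apply: eq_bigr => i _; rewrite vE.
    - exact: mem_index_enum.
  by rewrite scaler_eq0 (negbTE (x0 _)) orbF => /eqP.
by have := dimvS (subvf <<v>>); rewrite (eqP fv) size_tuple.
Qed.

(** The iterates have weights [a + b *+ k], pairwise distinct in characteristic zero. If none
    vanished, there would be more independent vectors than the dimension allows. *)
Lemma wt_nilpotent a b y z : wt b y -> b != 0 -> wt a z ->
  exists k, iter k (lie_br y) z = 0.
Proof.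
move=> hy /lfunPn [t]; rewrite zero_lfunE => bt hz; apply: contrapT => no.
pose N := (\dim {:g}).+1; suff : (N <= \dim {:g})%N by rewrite ltnn.
rewrite -[X in (X <= _)%N]card_ord.
apply: (@weight_vectors_dim 'I_N (fun i : 'I_N => a + b *+ i) (fun i => iter i (lie_br y) z)).
- move=> i1 i2 /addrI /lfunP /(_ t); rewrite !dualMn => e.
  exact/val_inj/(mulrIn bt).
- by move=> j; apply: wt_iter.
- by move=> i; apply/eqP => vk; apply: no; exists i.
Qed.

Lemma opposite_br_neq0 d y : wt (- val d) y -> B (X d) y != 0 -> lie_br (X d) y != 0.
Proof.
move=> hy Bxy; have /lfunPn [u] : (val d : dual_space h) != 0 := D_neq0 d.
rewrite zero_lfunE => du; apply: contraNneq du => H0.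
have : B (lie_br (X d) y) (vsval u) = 0 by rewrite H0 BC B0r.
rewrite B_br lie_brC hy opp_lfunE scaleNr opprK BZr => /eqP.
by rewrite mulf_eq0 (negbTE Bxy) orbF.
Qed.

Lemma opposite_br_cartan d y : wt (- val d) y -> lie_br (X d) y \in h.
Proof.
move=> hy; apply: (wt0_cartan h_cartan).
by rewrite -(subrr (val d)); apply: wt_br => //; apply: X_wt.
Qed.

(** The vectors for the roots [val d] and [- val d], together with one nonzero vector of [h], have
    distinct weights. The vector of [h] accounts for the strict inequality. *)
Lemma card_positive_roots (d0 : D) : (2 * #|{: D}| < \dim {:g})%N.
Proof.
have /choice [Y YP] : forall d, exists y, wt (- val d) y /\ B (X d) y != 0.
  by move=> d; have [y] := opposite_root_vector d; exists y.
have -> : (2 * #|{: D}|).+1 = #|{: option (D + D)}| by rewrite card_option card_sum mul2n addnn.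
pose w (i : option (D + D)) : dual_space h :=
  match i with Some (inl d) => val d | Some (inr d) => - val d | None => 0 end.
pose x (i : option (D + D)) :=
  match i with Some (inl d) => X d | Some (inr d) => Y d | None => lie_br (X d0) (Y d0) end.
apply: (@weight_vectors_dim _ w x).
- have sep d e : val d <> - val e by apply/eqP/D_opp.
  have nz d : val d <> 0 by apply/eqP/D_neq0.
  have nz' d : - val d <> 0 by move/eqP; rewrite oppr_eq0; apply/negP/D_neq0.
  move=> [[d|d]|] [[e|e]|] //= dE.
  + by rewrite (val_inj dE).
  + by case: (sep d e).
  + by case: (nz d).
  + by case: (sep e d).
  + by rewrite (val_inj (oppr_inj dE)).
  + by case: (nz' d).
  + by case: (nz e).
  + by case: (nz' e).
- move=> [[d|d]|]; [exact: X_wt | exact: (YP d).1 | ].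
  exact: (wt_cartan h_cartan (Subvs (opposite_br_cartan (YP d0).1))).
- move=> [[d|d]|] /=; first exact: X_neq0.
    by have [_] := YP d; apply: contraNneq => ->; rewrite B0r.
  exact: opposite_br_neq0 (YP d0).1 (YP d0).2.
Qed.

Lemma string_bracket a b (t : subvs_of h) x y v k :
  wt b x -> wt (- b) y -> lie_br x y = vsval t -> wt a v -> lie_br x v = 0 ->
  lie_br x (iter k.+1 (lie_br y) v) =
    (\sum_(i < k.+1) (a t - b t *+ i)) *: iter k (lie_br y) v.
Proof.
move=> hx hy xy hv xv.
have step j : lie_br x (iter j.+1 (lie_br y) v) =
    (a t - b t *+ j) *: iter j (lie_br y) v + lie_br y (lie_br x (iter j (lie_br y) v)).
  rewrite iterS lie_jacobi_der xy (wt_iter j hy hv) add_lfunE.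
  congr (_ *: _ + _); by rewrite dualMn opp_lfunE mulNrn.
elim: k => [|k IH].
  by rewrite step /= xv lie_br0r addr0 big_ord1.
by rewrite step IH lie_brZr -iterS [in RHS]big_ord_recr /= -scalerDl addrC.
Qed.

(** At the last nonzero iterate of [y], the coefficient in [string_bracket] must vanish; doubled, it
    equals [k.+1 * (2 * a t - b t *+ k)]. No normalization of [b t] is imposed, so that the case
    [b t = 0] can be used to rule itself out in [sl2_triple_exists]. *)
Lemma highest_weight a b (t : subvs_of h) x y v :
  wt b x -> wt (- b) y -> b != 0 -> lie_br x y = vsval t ->
  wt a v -> v != 0 -> lie_br x v = 0 -> exists k, 2 * (a t : K) = (b t : K) *+ k.
Proof.
move=> hx hy b0 xy hv v0 xv.
have ex : exists k, iter k (lie_br y) v == 0.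
  have [|k kP] := wt_nilpotent hy _ hv; first by rewrite oppr_eq0.
  by exists k; apply/eqP.
have [k /eqP yk0 kmin] := ex_minnP ex.
case: k yk0 kmin => [/= v00|k yk0 kmin]; first by rewrite v00 eqxx in v0.
have yk : iter k (lie_br y) v != 0 by apply/negP => /kmin; rewrite ltnn.
exists k; have := string_bracket k hx hy xy hv xv.
rewrite yk0 lie_br0r => /esym/eqP; rewrite scaler_eq0 (negbTE yk) orbF => /eqP s0.
have sumE n (p q : K) : 2 * \sum_(i < n.+1) (p - q *+ i) = n.+1%:R * (2 * p - q *+ n).
  elim: n => [|n IH]; first by rewrite big_ord1 !mulr0n !subr0 mul1r.
  have e2 : n.+2%:R = n%:R + 2 :> K by rewrite -addn2 natrD.
  have e1 : n.+1%:R = n%:R + 1 :> K by rewrite -addn1 natrD.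
  by rewrite big_ord_recr /= mulrDr IH -!(mulr_natr q) e1 e2; ring.
have := sumE k (a t) (b t); rewrite s0 mulr0 => /esym/eqP.
by rewrite mulf_eq0 pnatr_eq0 /= subr_eq0 => /eqP.
Qed.

Hypothesis center0 : forall x, (forall y, lie_br x y = 0) -> x = 0.

Definition sl2_triple d y (t : subvs_of h) : Prop :=
  [/\ wt (- val d) y, lie_br (X d) y = vsval t & (val d : dual_space h) t = 2%:R].

Lemma sl2_triple_exists d : exists y t, sl2_triple d y t.
Proof.
have [y hy Bxy] := opposite_root_vector d.
pose t : subvs_of h := Subvs (opposite_br_cartan hy).
have tE : lie_br (X d) y = vsval t by [].
have [dt0|dt0] := eqVneq ((val d : dual_space h) t) 0; last first.
  exists ((2 / (val d : dual_space h) t) *: y), ((2 / (val d : dual_space h) t) *: t).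
  split; first exact: wtZ.
    by rewrite lie_brZr tE linearZ.
  by rewrite linearZ /= -[LHS]/(_ * _) divfK.
(* If [val d] vanished at [t], raising a weight vector by [X d] to a highest one would force its
   weight to vanish at [t] too. Then [[X d, y]] would be central, hence zero. *)
have wt0 c z : wt c z -> z != 0 -> c t = 0.
  move=> hz z0.
  have ex : exists k, iter k (lie_br (X d)) z == 0.
    by have [k kP] := wt_nilpotent (X_wt d) (D_neq0 d) hz; exists k; apply/eqP.
  have [[/eqP /= z00|k /eqP xk kmin]] := ex_minnP ex; first by rewrite z00 eqxx in z0.
  have vk : iter k (lie_br (X d)) z != 0 by apply/negP => /kmin; rewrite ltnn.
  have [m] := highest_weight (X_wt d) hy (D_neq0 d) tE (wt_iter k (X_wt d) hz) vk xk.
  rewrite dt0 mul0rn add_lfunE dualMn dt0 mul0rn addr0 => /eqP.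
  by rewrite mulf_eq0 pnatr_eq0 /= => /eqP.
suff H0 : lie_br (X d) y = 0 by have := opposite_br_neq0 hy Bxy; rewrite H0 eqxx.
apply: center0 => z; have [s [-> hs]] := weight_decomposition h_cartan z.
rewrite lie_br_sumr big1_seq // => u /andP [_ /hs [c hu]].
have [->|u0] := eqVneq u 0; first exact: lie_br0r.
by rewrite tE hu (wt0 c u hu u0) scale0r.
Qed.

Lemma sl2_triple_highest d y t c v : sl2_triple d y t ->
  wt c v -> v != 0 -> lie_br (X d) v = 0 -> exists k : nat, c t = k%:R :> K.
Proof.
move=> [hy xy dt] hv v0 xv.
have [k] := highest_weight (X_wt d) hy (D_neq0 d) xy hv v0 xv.
rewrite dt => e; exists k.
by apply: (@mulfI K 2); [rewrite pnatr_eq0 | rewrite e mulr_natr].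
Qed.

(** Induction on the length. If [X d] has a nonzero bracket with some [X e] of the list, then [d]
    and [e] merge into one positive root. Otherwise every other member is a highest weight for the
    triple of [d], so the sum takes a value at least 2 at [t]. *)
Lemma positive_sum_neq0 (s : seq D) : s != [::] -> \sum_(d <- s) val d != 0.
Proof.
have [n] := ubnP (size s); elim: n s => // n IH [//|d s] sn _.
rewrite big_cons; have [y [t yt]] := sl2_triple_exists d.
case: (pselect (exists2 e, e \in s & lie_br (X d) (X e) != 0)) => [[e es de]|no].
  have [f fE] := D_add de.
  rewrite (big_rem e) //= addrA -fE.
  have := IH (f :: rem e s); rewrite big_cons; apply=> //.
  have : (0 < size s)%N by case: (s) es.
  by rewrite /= size_rem //; move: sn => /=; lia.
have nat_s : exists k : nat, (\sum_(e <- s) val e : dual_space h) t = k%:R.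
  have : {in s, forall e, exists k : nat, (val e : dual_space h) t = k%:R}.
    move=> e es; apply: (sl2_triple_highest yt (X_wt e) (X_neq0 e)).
    by apply/eqP; apply: contrapT => /negP de; apply: no; exists e.
  elim: (s) => [|e s' IHs] hs; first by exists 0; rewrite big_nil zero_lfunE.
  have [k ke] := hs e (mem_head _ _).
  have [|m me] := IHs; first by move=> f fs; apply: hs; rewrite inE fs orbT.
  by exists (k + m)%N; rewrite big_cons add_lfunE ke me natrD.
have [k kE] := nat_s; have [_ _ dt] := yt.
apply/eqP => /lfunP /(_ t); rewrite add_lfunE zero_lfunE kE dt -natrD => /eqP.
by rewrite pnatr_eq0.
Qed.

Lemma central_root_vector (d0 : D) : exists d, forall e, lie_br (X d) (X e) = 0.
Proof.
(* [up d e] says that [e] exceeds [d] by a nonempty sum of positive roots. A [d] with fewest roots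
   above it works: if [f = d + e] were a root, all roots above [f] would lie above [d], and [f]
   itself would be above [d] but not above [f]. *)
pose up (d e : D) := `[< exists2 s : seq D, s != [::] & val e = val d + \sum_(f <- s) val f >].
pose d := [arg min_(d < d0) #|[pred e | up d e]|].
exists d => e; apply/eqP; apply: contrapT => /negP /D_add [f fE].
move: fE; rewrite /d; case: arg_minnP => // {}d _ dmin fE.
have /(_ isT) := dmin f; rewrite leqNgt => /negP; apply.
apply: proper_card; apply/properP; split.
  apply/subsetP => u /asboolP [s s0 uE]; apply/asboolP; exists (e :: s) => //.
  by rewrite big_cons uE fE addrA.
exists f; first by apply/asboolP; exists [:: e]; rewrite ?big_seq1.
apply/asboolPn => -[s s0 /eqP]; rewrite -subr_eq0 opprD addNKr oppr_eq0.
by apply/negP/positive_sum_neq0.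
Qed.

(** Isolates what the degeneracy argument needs from the grading by the coroot of [q]. [L] is the
    part of degree one, which together with [q] gives a Heisenberg algebra; [level_add] reflects
    that a root outside [L] other than [q] has degree zero. *)
Record highest_root_level (q : D) (L : {set D}) : Prop := HighestRootLevel {
  level_central : forall d, lie_br (X q) (X d) = 0;
  level_partner : forall d, d \in L -> exists2 e, e \in L & val d + val e = val q;
  level_mem : forall d e, val d + val e = val q -> d \in L;
  level_br_neq0 : forall d e, val d + val e = val q -> lie_br (X d) (X e) != 0;
  level_br_eq0 : forall d e, d \in L -> e \in L -> val d + val e != val q ->
    lie_br (X d) (X e) = 0;
  level_add : forall d e f : D, d \notin L -> d != q -> e \in L ->
    val f = val d + val e -> f \in L;
  level_card : (2 < #|L|)%N }.

(** * The grading defined by a root with central root vector *)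

Section HighestRoot.
Variables (q : D) (y : g) (t : subvs_of h).
Hypothesis q_central : forall d, lie_br (X q) (X d) = 0.
Hypothesis qyt : sl2_triple q y t.
Let p d : K := (val d : dual_space h) t.

Let hy : wt (- val q) y. Proof. by case: qyt. Qed.
Let pq : p q = 2. Proof. by case: qyt. Qed.
Let qy d : lie_br (X q) (lie_br y (X d)) = p d *: X d.
Proof.
by case: qyt => _ e _; rewrite lie_jacobi_der e q_central lie_br0r addr0 (X_wt d).
Qed.
Let p_nat d : exists k : nat, p d = k%:R.
Proof. exact: sl2_triple_highest qyt (X_wt d) (X_neq0 d) (q_central d). Qed.

(* [X q] kills [g_a] for every [a] in [D], so a weight vector which it does
   not kill has a negative weight. *)
Let not_killed z c : wt c z -> lie_br (X q) z != 0 -> c != 0 -> exists d, val d = - c.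
Proof.
move=> hz qz c0; have z0 : z != 0 by apply: contraNneq qz => ->; rewrite lie_br0r.
case: (wt_root hz z0 c0) => // -[d dc]; rewrite -dc in hz.
by have [k zE] := X_line hz; rewrite zE lie_brZr q_central scaler0 eqxx in qz.
Qed.

(** The vector [[y, X d]] has weight [val d - val q] and is sent by [X q] to [p d *: X d], which is
    nonzero; so [not_killed] applies to it. *)
Let height_neq0 d : p d != 0 -> d != q -> exists e, val e = val q - val d.
Proof.
move=> pd dq.
have [||e eE] := not_killed (wt_br hy (X_wt d)).
- by rewrite qy scaler_eq0 negb_or pd X_neq0.
- by rewrite addrC subr_eq0 (inj_eq val_inj).
- by exists e; rewrite eE opprD opprK.
Qed.

Let p_sum d e f : val f = val d + val e -> p f = p d + p e.
Proof. by rewrite /p => ->; rewrite add_lfunE. Qed.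

Let height_le1 d : d != q -> p d = 0 \/ p d = 1.
Proof.
move=> dq; have [->|pd] := eqVneq (p d) 0; [by left | right].
have [e eE] := height_neq0 pd dq.
have : p q = p d + p e by apply: p_sum; rewrite eE addrC subrK.
have [k kE] := p_nat d; have [l lE] := p_nat e.
rewrite pq kE lE -natrD => /eqP; rewrite eqr_nat => /eqP kl.
case: k kE kl => [|[|[|k]]] kE kl //; first by rewrite kE eqxx in pd.
(* The remaining case is degree 2. There [X q] does not kill [[y, [y, X d]]], so [f = 2 q - d] is a
   positive root, again of degree 2. Then [q - f = d - q] is positive, while its opposite
   [e = q - d] is positive too. *)
have qyy : lie_br (X q) (lie_br y (lie_br y (X d))) = 2 *: lie_br y (X d).
  have [_ xy _] := qyt.
  rewrite lie_jacobi_der xy (wt_br hy (X_wt d)) qy lie_brZr -scalerDl.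
  rewrite add_lfunE opp_lfunE -[X in (- X + _ + _) *: _]/(p q) -[X in (_ + X + _) *: _]/(p d).
  by rewrite pq kE addNr add0r.
have yd0 : lie_br y (X d) != 0.
  apply: contraNneq (X_neq0 d) => yd0; have := qy d.
  by rewrite yd0 lie_br0r kE => /esym/eqP; rewrite scaler_eq0 pnatr_eq0.
have [||f fE] := not_killed (wt_br hy (wt_br hy (X_wt d))).
- by rewrite qyy scaler_eq0 pnatr_eq0.
- apply/lfunPn; exists t; rewrite zero_lfunE !add_lfunE !opp_lfunE.
  rewrite -[X in - X + (- X + _)]/(p q) -[X in _ + (_ + X)]/(p d) pq kE addNr addr0.
  by rewrite oppr_eq0 pnatr_eq0.
have {}fE : val d + val f = val q + val q.
  by rewrite fE !opprD !opprK addrC -!addrA addNr addr0.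
have fq : f != q.
  by apply: contraNneq dq => fq; rewrite fq in fE; rewrite -(inj_eq val_inj) (addIr _ fE).
have pf : p f = 2.
  have : p d + p f = p q + p q by have := congr1 (fun a : dual_space h => a t) fE; rewrite !add_lfunE.
  by rewrite kE pq => /addrI.
have [|e' e'E] := height_neq0 _ fq; first by rewrite pf pnatr_eq0.
case/negP: (D_opp e e').
by rewrite eE e'E opprB subr_eq addrAC eq_sym subr_eq (addrC (val f)) fE.
Qed.

Hypothesis ad_rank : forall x (W : {vspace g}),
  x != 0 -> (forall z, lie_br z x \in W) -> (4 < \dim W)%N.

Let L := [set d | p d == 1].

Let level1_partner d : d \in L -> exists2 e, e \in L & val d + val e = val q.
Proof.
rewrite inE => /eqP pd.
have [||e eE] := @height_neq0 d.
- by rewrite pd oner_eq0.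
- by apply: contra_eq_neq pd => ->; rewrite pq -subr_eq0 -(natrB _ (leqnSn 1)) oner_eq0.
have {}eE : val q = val d + val e by rewrite eE addrC subrK.
exists e => //; rewrite inE; have := p_sum eE.
by rewrite pq pd => /eqP; rewrite -subr_eq0 opprD addrA subr_eq0 (addrK 1 1) eq_sym.
Qed.

Let level1 d e : val d + val e = val q -> d \in L.
Proof.
move=> de; have dq : d != q.
  apply: contraNneq (D_neq0 e) => dq; rewrite dq in de.
  by rewrite -(inj_eq (addrI (val q))) de addr0.
have eq : e != q.
  apply: contraNneq (D_neq0 d) => eq; rewrite eq in de.
  by rewrite -(inj_eq (addIr (val q))) de add0r.
have := p_sum (esym de); rewrite pq inE.
case: (height_le1 dq) (height_le1 eq) => -> [] ->; rewrite ?eqxx // ?add0r ?addr0.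
- by move/eqP; rewrite pnatr_eq0.
- by move/eqP; rewrite -subr_eq0 -(natrB _ (leqnSn 1)) oner_eq0.
Qed.

(** [[y, X d]] is a nonzero vector of weight [- val e], so it pairs non-trivially with [X e]; by
    invariance this pairing is [B y [X d, X e]]. *)
Let level1_br_neq0 d e : val d + val e = val q -> lie_br (X d) (X e) != 0.
Proof.
move=> de; have : p d = 1 by apply/eqP; have := level1 de; rewrite inE.
move=> pd; have yd : lie_br y (X d) != 0.
  apply: contraNneq (X_neq0 d) => yd0; have := qy d.
  by rewrite yd0 lie_br0r pd scale1r => <-.
have wyd : wt (- val e) (lie_br y (X d)).
  by have := wt_br hy (X_wt d); rewrite -de opprD addrC addrA subrr add0r.
have := X_pairing wyd yd; rewrite B_br.
by apply: contraNneq => ->; rewrite B0r.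
Qed.

Let level1_br0 d e : d \in L -> e \in L -> val d + val e != val q ->
  lie_br (X d) (X e) = 0.
Proof.
rewrite !inE => /eqP pd /eqP pe deq; apply/eqP; apply: contraNT deq => /D_add [f fE].
have := p_sum fE; rewrite pd pe => pf; rewrite -fE.
have [->//|fq] := eqVneq f q.
have [|] := height_le1 fq; rewrite pf.
- by move/eqP; rewrite -mulr2n pnatr_eq0.
- by move/eqP; rewrite -subr_eq0 addrK oner_eq0.
Qed.

Let level1_add (d e f : D) : d \notin L -> d != q -> e \in L -> val f = val d + val e ->
  f \in L.
Proof.
rewrite !inE => pd dq /eqP pe fE; rewrite (p_sum fE) pe.
have [->|pd1] := height_le1 dq; first by rewrite add0r.
by rewrite pd1 eqxx in pd.
Qed.

Let card_level1 : (2 < #|L|)%N.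
Proof.
(* [W] contains the image of [ad (X q)] and has dimension at most [2 + #|L|], which the rank
   hypothesis compares with 5. *)
pose W := (<[X q]> + (<[vsval t]> + <<[seq X d | d <- enum L]>>))%VS.
have XqW : X q \in W by rewrite memvE addvSl.
have tW : vsval t \in W by rewrite memvE; apply: subv_trans (addvSr _ _); apply: addvSl.
have XLW d : d \in L -> X d \in W.
  move=> dL; rewrite memvE; apply: subv_trans (addvSr _ _).
  apply: subv_trans (addvSr _ _); rewrite -memvE memv_span //.
  by rewrite map_f ?mem_enum.
have brW z : lie_br z (X q) \in W.
  have [s [-> hs]] := weight_decomposition h_cartan z.
  rewrite lie_br_suml big_seq; apply: memv_suml => u /hs [c hu].
  set v := lie_br u (X q); have hv : wt (c + val q) v := wt_br hu (X_wt q).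
  have [->|v0] := eqVneq v 0; first exact: mem0v.
  have u0 : u != 0 by apply: contraNneq v0; rewrite /v => ->; rewrite lie_br0l.
  have [c0|c0] := eqVneq c 0.
    rewrite c0 in hu; have uh := wt0_cartan h_cartan hu.
    by rewrite /v (X_wt q (Subvs uh)) memvZ.
  have [[d dc]|[d dc]] := wt_root hu u0 c0.
    rewrite -dc in hu; have [k uE] := X_line hu.
    by rewrite /v uE lie_brZl lie_brC q_central oppr0 scaler0 eqxx in v0.
  have {}dc : c = - val d by rewrite dc opprK.
  rewrite {}dc in hu hv; have [dq|dq] := eqVneq d q.
    (* For [c = - val q], non-degeneracy of the form makes the weight space a line through [y], and
       [[y, X q]] is [- t]. *)
    have yq := qyt; case: yq => _ xy tq; rewrite dq in hu.
    have y0 : y != 0.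
      apply: contra_eq_neq tq => y0; move: xy; rewrite y0 lie_br0r => /esym/eqP.
      by rewrite -(raddf0 (@vsval _ _ h)) (inj_eq val_inj) => /eqP ->; rewrite linear0 eq_sym pnatr_eq0.
    pose k := B u (X q) / B y (X q).
    have uE : u = k *: y.
      apply/eqP; rewrite -subr_eq0; apply: contraT.
      move=> /(X_pairing (wtB hu (wtZ k hy))); rewrite BC BDr -scaleN1r !BZr.
      by rewrite !(BC (X q)) divfK ?X_pairing // mulN1r subrr eqxx.
    by rewrite /v uE lie_brZl lie_brC xy memvZ ?memvN.
  have ne : - val d + val q != 0 by rewrite addrC subr_eq0 eq_sym (inj_eq val_inj).
  have [[e eE]|[e eE]] := wt_root hv v0 ne.
    rewrite -eE in hv; have [k ->] := X_line hv; apply/memvZ/XLW/(@level1 e d).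
    by rewrite eE addrAC addNr add0r.
  (* If [q - d] were a negative root, [v] would pair non-trivially with [X e]; yet this pairing
     equals [B u [X q, X e]], and [X q] commutes with [X e]. *)
  have hv' : wt (- val e) v by rewrite eE opprK.
  by have := X_pairing hv' v0; rewrite B_br q_central B0r eqxx.
have := ad_rank (X_neq0 q) brW.
have : (\dim W <= 1 + (1 + #|L|))%N.
  apply: leq_trans (dimv_add_leqif _ _).1 _; rewrite dim_vline leq_add ?leq_b1 //.
  apply: leq_trans (dimv_add_leqif _ _).1 _; rewrite dim_vline leq_add ?leq_b1 //.
  by apply: leq_trans (dim_span _) _; rewrite size_map -cardE.
lia.
Qed.

Lemma highest_root_levelP : highest_root_level q L.
Proof. by split. Qed.

End HighestRoot.

End RootSystem.

Lemma highest_root_level_exists (K : numFieldType) (g : lieAlg K) (h : {vspace g})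
    (D : {fset dual_space h}) (X : D -> g) (B : g -> g -> K^o) (d0 : D) :
  is_cartan h -> is_positive_system D ->
  (forall (a : D) (y : g), in_root_space (val a) y <-> y \in <[X a]>%VS) ->
  invariant_form B ->
  (forall (x : g) (W : {vspace g}), x != 0 -> (forall z, lie_br z x \in W) -> (4 < \dim W)%N) ->
  exists q L, highest_root_level X q L.
Proof.
move=> hC hD hX hB rk.
have center0 (x : g) : (forall y, lie_br x y = 0) -> x = 0.
  move=> x0; apply/eqP; apply: contraT => /(rk x 0%VS).
  by rewrite dimv0; apply=> z; rewrite lie_brC x0 oppr0 mem0v.
have [q qc] := central_root_vector hC hD hX hB center0 d0.
have [y [t yt]] := sl2_triple_exists hC hD hX hB center0 q.
by exists q; eexists; apply: (highest_root_levelP hC hD hX hB qc yt rk).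
Qed.

(** * Closed forms vanish on the central root vector *)

Section StructureConstants.
Variables (F K : numFieldType) (iota : {rmorphism F -> K}).
Variables (g : lieAlg K) (h : {vspace g}) (D : {fset dual_space h}) (X : D -> g).
Variables (c : D -> D -> D -> F) (a : lieAlg F) (v : D -> a).
Hypothesis h_cartan : is_cartan h.
Hypothesis D_pos : is_positive_system D.
Hypothesis X_span : forall (a : D) (y : g), in_root_space (val a) y <-> y \in <[X a]>%VS.
Hypothesis X_br : forall d e, lie_br (X d) (X e) = \sum_f iota (c d e f) *: X f.
Hypothesis v_br : forall d e, lie_br (v d) (v e) = \sum_f c d e f *: v f.

Lemma root_vectors_free (k : D -> K) : \sum_f k f *: X f = 0 -> forall f, k f = 0.
Proof.
move=> sum0 f; have /eqP : k f *: X f = 0.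
  apply: (weight_free (s := index_enum D) (w := val) (x := fun f => k f *: X f)).
  - exact: index_enum_uniq.
  - by move=> d e _ _; apply: val_inj.
  - by move=> e _; apply/wtZ/X_wt.
  - exact: sum0.
  - exact: mem_index_enum.
by rewrite scaler_eq0 (negbTE (X_neq0 D_pos X_span f)) orbF => /eqP.
Qed.

(** The two families share their constants up to the injective [iota], and the [X] are independent,
    so vanishing brackets of the [X] force the constants, hence the brackets of the [v], to
    vanish. *)
Lemma v_br_eq0 d e : lie_br (X d) (X e) = 0 -> lie_br (v d) (v e) = 0.
Proof.
rewrite X_br => /root_vectors_free c0; rewrite v_br big1 // => f _.
by have /eqP := c0 f; rewrite fmorph_eq0 => /eqP ->; rewrite scale0r.
Qed.

Lemma br_sum (d e f : D) : val f = val d + val e ->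
  lie_br (v d) (v e) = c d e f *: v f /\ lie_br (X d) (X e) = iota (c d e f) *: X f.
Proof.
move=> fE; have : in_root_space (val f) (lie_br (X d) (X e)).
  by rewrite fE; apply: wt_br; apply: X_wt.
move=> /(X_line X_span) [k brE].
have c0 f' : f' != f -> c d e f' = 0.
  move=> ff'; have := @root_vectors_free (fun u => iota (c d e u) - k *+ (u == f)).
  move=> /(_ _ f'); rewrite (negbTE ff') mulr0n subr0 => cf.
  apply/eqP; rewrite -(fmorph_eq0 iota); apply/eqP/cf.
  under eq_bigr do rewrite scalerBl.
  rewrite sumrB -X_br brE [X in _ - X](bigD1 f) //= eqxx mulr1n big1 ?addr0 ?subrr //.
  by move=> u /negbTE ->; rewrite mulr0n scale0r.
rewrite X_br v_br; split; rewrite (bigD1 f) //= big1 ?addr0 // => u uf.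
  by rewrite c0 // scale0r.
by rewrite c0 // rmorph0 scale0r.
Qed.

Section Degenerate.
Variables (q : D) (L : {set D}) (w : a -> a -> F).
Hypothesis qL : highest_root_level X q L.
Hypothesis wZ : forall k x y, w x (k *: y) = k * w x y.
Hypothesis wC : forall x y, w x y = - w y x.
Hypothesis w_closed : forall x y z,
  w (lie_br x y) z + w (lie_br y z) x + w (lie_br z x) y = 0.
Hypothesis vq : v q != 0.

Let w0 x : w x 0 = 0. Proof. by rewrite -(scale0r 0) wZ mul0r. Qed.
Let w0l x : w 0 x = 0. Proof. by rewrite wC w0 oppr0. Qed.
Let wZl k x y : w (k *: x) y = k * w x y.
Proof. by rewrite wC wZ -mulrN -wC. Qed.
Let wNl x y : w (- x) y = - w x y. Proof. by rewrite -scaleN1r wZl mulN1r. Qed.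

Let level_const (d e : D) : val d + val e = val q ->
  c d e q != 0 /\ lie_br (v d) (v e) = c d e q *: v q.
Proof.
move=> de; have [-> XE] := br_sum (esym de); split=> //.
have := level_br_neq0 qL de; rewrite XE; apply: contraNneq => ->.
by rewrite rmorph0 scale0r.
Qed.

(** In the closedness relation for [v d], [v e] and [z], only the term of [[v d, v e]] survives, and
    this bracket is a nonzero multiple of [v q]. *)
Lemma w_commuting (d e : D) z : val d + val e = val q ->
  lie_br (v d) z = 0 -> lie_br (v e) z = 0 -> w (v q) z = 0.
Proof.
move=> /level_const [c0 brE] dz ez; have := w_closed (v d) (v e) z.
rewrite brE ez (lie_brC z) dz oppr0 !w0l !addr0 wZl => /eqP.
by rewrite mulf_eq0 (negbTE c0) => /eqP.
Qed.

Lemma level_nonempty : exists d e : D, val d + val e = val q.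
Proof.
have /card_gt0P [d dL] : (0 < #|L|)%N by apply: leq_trans (level_card qL).
by have [e _ de] := level_partner qL dL; exists d, e.
Qed.

Section Level0.
Variable al : D.
Hypothesis (alL : al \notin L) (alq : al != q).

(** The default [q] of [insubd] stands in when the difference is not a positive root. On [L] the
    value of [s] is the true difference, and so is that of [ta] on [A]. *)
Let s (d : D) : D := insubd q (val q - val d).
Let ta (d : D) : D := insubd q (val q - val al - val d).
Let A := [set d in L | [exists e : D, val e == val al + val d]].
Let N d := c d (s d) q.
Let f d := (N d)^-1 * w (lie_br (v al) (v d)) (v (s d)).

Let sE (d e : D) : val d + val e = val q -> s d = e.
Proof.
by move=> de; apply: val_inj; rewrite /s -de addrAC subrr add0r val_insubd (valP e).
Qed.

Let sP d : d \in L -> s d \in L /\ val d + val (s d) = val q.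
Proof. by move=> dL; have [e eL de] := level_partner qL dL; rewrite (sE de). Qed.

Let sK d : d \in L -> s (s d) = d.
Proof. by move=> /sP [_ de]; apply: sE; rewrite addrC. Qed.

Let NP d : d \in L -> N d != 0 /\ lie_br (v d) (v (s d)) = N d *: v q.
Proof. by move=> /sP [_ /level_const]. Qed.

Let Ns d : d \in L -> N (s d) = - N d.
Proof.
move=> dL; have [sL _] := sP dL; have [_ dE] := NP dL; have [_] := NP sL.
rewrite sK // lie_brC dE -scaleNr => /eqP; rewrite -subr_eq0 -scalerBl scaler_eq0.
by rewrite (negbTE vq) orbF subr_eq0 => /eqP ->.
Qed.

Let f_eq0 d : d \in L -> d \notin A -> f d = 0.
Proof.
rewrite inE => -> /=; rewrite negb_exists => /forallP no.
rewrite /f v_br_eq0 ?w0l ?mulr0 //; apply/eqP; apply: contraT.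
by move=> /(D_add D_pos X_span) [e eE]; have := no e; rewrite eE eqxx.
Qed.

(** The closedness relation for [v d], [v (s d)] and [v al], divided by [N d]; the sign of the last
    term is absorbed by [N (s d) = - N d]. *)
Let closed_level d : d \in L -> w (v q) (v al) + f d + f (s d) = 0.
Proof.
move=> dL; have [N0 dE] := NP dL.
have := w_closed (v d) (v (s d)) (v al); rewrite dE wZl /f sK // Ns //.
move=> e; apply: (mulfI N0); rewrite mulr0 -[RHS]e !mulrDr invrN mulNr mulrN !mulVKf //.
rewrite addrAC; congr (_ + _ + _).
by rewrite [in RHS]lie_brC wNl.
Qed.

(* The sign comes from the Jacobi identity for [al], [d] and [ta d]: their sum
   is [q], and [q - al], the sum of [d] and [ta d], is not a root. *)
Let taP d : d \in A -> [/\ ta d \in A, ta (ta d) = d & f (ta d) = - f d].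
Proof.
rewrite inE => /andP [dL /existsP [e /eqP eE]].
have eL : e \in L := level_add qL alL alq dL eE.
have [seL eq] := sP eL; have [sdL dq] := sP dL.
have taE : ta d = s e by rewrite /ta /s eE opprD addrA.
have sdE : val (s d) = val al + val (s e).
  by apply: (addrI (val d)); rewrite dq -eq eE addrCA addrA.
have taA : ta d \in A.
  by rewrite inE taE seL; apply/existsP; exists (s d); rewrite sdE.
have tata : ta (ta d) = d.
  rewrite taE /ta; apply: val_inj; rewrite val_insubd.
  have -> : val q - val al - val (s e) = val d.
    by rewrite -eq eE [LHS]addrAC addrK addrAC subrr add0r.
  by rewrite (valP d).
split=> //; have [Ne eqE] := NP eL; have [Nd dqE] := NP dL.
have [M1E _] := br_sum eE; have [M2E _] := br_sum sdE.
have comm : lie_br (v d) (v (s e)) = 0.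
  apply: v_br_eq0; apply: (level_br_eq0 qL) => //.
  rewrite -eq eE (inj_eq (addIr _)) -subr_eq0 opprD addrCA subrr addr0 oppr_eq0.
  exact: D_neq0 D_pos al.
have := lie_jacobi_der (v al) (v d) (v (s e)); rewrite comm lie_br0r M1E M2E.
rewrite lie_brZl lie_brZr eqE dqE !scalerA -scalerDl => /esym/eqP.
rewrite scaler_eq0 (negbTE vq) orbF addr_eq0 => /eqP jac.
rewrite /f taE M1E M2E Ns // sK // !wZl (wC (v (s d))).
move: (w _ _) => W; apply: (mulfI Nd); apply: (mulfI Ne).
rewrite invrN; move: jac.
set M1 := c al d e; set M2 := c al (s e) (s d) => jac.
have -> : N e * (N d * (- (N e)^-1 * (M2 * - W))) = (N e / N e) * (M2 * N d) * W by ring.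
have -> : N e * (N d * - ((N d)^-1 * (M1 * W))) = - ((N d / N d) * (M1 * N e) * W) by ring.
by rewrite !divff // jac; ring.
Qed.

Lemma w_level0 : w (v q) (v al) = 0.
Proof.
have sumA : \sum_(d in L) f d = \sum_(d in A) f d.
  rewrite (bigID [in A]) /= [X in _ + X]big1 ?addr0; last first.
    by move=> d /andP [dL dA]; apply: f_eq0.
  by apply: eq_bigl => d; rewrite inE andbA andbb.
(* Reindexing by the involution [ta] turns the sum into its opposite. *)
have sumA0 : \sum_(d in A) f d = 0.
  apply/eqP; have : \sum_(d in A) f d = - \sum_(d in A) f d.
    rewrite {1}(reindex_onto ta ta) => [|d /taP [] //].
    rewrite -sumrN; apply: eq_big => [d|d /andP [tdA /eqP tdK]].
      apply/andP/idP => [[tdA /eqP tdK]|/taP [-> -> _]//].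
      by have [] := taP tdA; rewrite tdK.
    by have [] := taP tdA; rewrite tdK => dA _; have [_ _ ->] := taP dA.
  by move/eqP; rewrite -addr_eq0 -mulr2n mulrn_eq0.
have sums : \sum_(d in L) f (s d) = \sum_(d in L) f d.
  rewrite [RHS](reindex_onto s s) => [|d /sK //].
  apply: eq_bigl => d; apply/idP/andP => [dL|[sL /eqP <-]]; last by case: (sP sL).
  by have [-> _] := sP dL; rewrite sK // eqxx.
have : \sum_(d in L) (w (v q) (v al) + f d + f (s d)) = 0.
  by rewrite big1 // => d; apply: closed_level.
rewrite !big_split /= sums sumA sumA0 !addr0 sumr_const => /eqP.
by rewrite mulrn_eq0 -leqn0 leqNgt (leq_trans _ (level_card qL)) //= => /eqP.
Qed.

End Level0.

Lemma w_root_vector al : w (v q) (v al) = 0.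
Proof.
have [->|alq] := eqVneq al q.
  by apply/eqP; have /eqP := wC (v q) (v q); rewrite -addr_eq0 -mulr2n mulrn_eq0.
have [alL|] := boolP (al \in L); last by move=> alL; apply: w_level0.
have [al' _ alE] := level_partner qL alL.
(* With at least three elements in [L], some [d] differs from [al] and its partner [al']. The
   partner [e] of [d] then differs from [al'] as well, so neither [d + al] nor [e + al] equals
   [q]. *)
have /card_gt0P [d] : (0 < #|L :\: [set al; al']|)%N.
  rewrite cardsD subn_gt0; apply: leq_ltn_trans (level_card qL).
  apply: leq_trans (subset_leq_card (subsetIr _ _)) _.
  by rewrite cards2; case: (_ != _).
rewrite !inE negb_or => /andP [/andP [dal dal'] dL].
have [e eL de] := level_partner qL dL.
apply: (w_commuting de); apply: v_br_eq0; apply: (level_br_eq0 qL) => //.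
  by rewrite -alE; apply: contraNneq dal' => /eqP; rewrite addrC => /eqP /addrI /val_inj ->.
by rewrite -de (addrC (val d)); apply: contraNneq dal => /addrI /val_inj ->.
Qed.

End Degenerate.
End StructureConstants.

(** * Symplectic forms from a matching of a basis *)

Section DarbouxForm.
Variables (K : fieldType) (V : vectType K) (m : nat) (phi : nat -> 'Hom(V, K^o)).
Let f i x : K := phi i x.

Definition darboux_form (x y : V) : K :=
  \sum_(k < m) (f k.*2 x * f k.*2.+1 y - f k.*2.+1 x * f k.*2 y).

Let fB i x y : f i (x - y) = f i x - f i y. Proof. exact: (raddfB (phi i)). Qed.
Let fZ i c x : f i (c *: x) = c * f i x. Proof. by rewrite /f linearZ. Qed.

Fact darboux_form_skew x y : darboux_form x y = (-1) ^+ true * idfun (darboux_form y x).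
Proof.
rewrite expr1 mulN1r /darboux_form -sumrN; apply: eq_bigr => k _ /=.
by rewrite opprB mulrC [X in _ - X]mulrC.
Qed.

Fact darboux_formBr x : zmod_morphism (darboux_form x).
Proof.
move=> u v; rewrite /darboux_form -sumrB; apply: eq_bigr => k _.
by rewrite !fB; ring.
Qed.

Fact darboux_formBl y : zmod_morphism (darboux_form^~ y).
Proof.
move=> u v; rewrite /darboux_form -sumrB; apply: eq_bigr => k _.
by rewrite !fB; ring.
Qed.

Fact darboux_formZr x : scalable_for (idfun \; *%R) (darboux_form x).
Proof.
move=> c u; rewrite /darboux_form /= mulr_sumr; apply: eq_bigr => k _.
by rewrite !fZ; ring.
Qed.

Fact darboux_formZl y : scalable_for *%R (darboux_form^~ y).
Proof.
move=> c u; rewrite /darboux_form /= mulr_sumr; apply: eq_bigr => k _.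
by rewrite !fZ; ring.
Qed.

HB.instance Definition _ := isBilinear.Build K V V K *%R (idfun \; *%R) darboux_form
  darboux_formBl darboux_formBr darboux_formZl darboux_formZr.
HB.instance Definition _ :=
  isHermitianSesquilinear.Build K V true idfun darboux_form darboux_form_skew.
End DarbouxForm.

(** The involution exchanging [2k] and [2k + 1], that is, the positions paired by [darboux_form]. *)
Definition mate (n : nat) : nat := if odd n then n.-1 else n.+1.

Section DarbouxBasis.
Variables (K : fieldType) (a : lieAlg K) (e : seq a).
Hypothesis e_basis : basis_of fullv e.
Hypothesis e_even : ~~ odd (size e).
Hypothesis e_br : {in e &, forall u v, u != v -> exists c w, [/\ lie_br u v = c *: w,
  w \in e & c != 0 -> mate (index w e) = index u e \/ mate (index w e) = index v e]}.

(** The sum has at most one term; it is the zero functional for [i] beyond the end of [e]. *)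
Let coordinate (i : nat) : 'Hom(a, K^o) :=
  \sum_(j < size e | j == i :> nat) linfun (coord (in_tuple e) j : a -> K^o).

Let coordinate_coord (j : 'I_(size e)) u : coordinate j u = coord (in_tuple e) j u.
Proof.
by rewrite /coordinate (big_pred1 j) ?lfunE.
Qed.

Let coordinateE i u : u \in e -> (i < size e)%N -> coordinate i u = (i == index u e)%:R.
Proof.
move=> ue ie; have iu : (index u e < size e)%N by rewrite index_mem.
have uE : u = (in_tuple e)`_(Ordinal iu) by rewrite /= nth_index.
rewrite (coordinate_coord (Ordinal ie)) {1}uE coord_free ?(basis_free e_basis) //.
by rewrite -(inj_eq val_inj) eq_sym.
Qed.

Let w := darboux_form (size e)./2 coordinate.

Lemma basis_ind (P : a -> Prop) : P 0 -> (forall c u v, P u -> P v -> P (c *: u + v)) ->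
  {in e, forall u, P u} -> forall u, P u.
Proof.
move=> P0 PD Pe u; have ue : u \in <<in_tuple e>>%VS by rewrite (span_basis e_basis) memvf.
rewrite (coord_span ue); elim/big_rec: _ => // i v _ Pv.
by apply: PD => //; apply: Pe; rewrite mem_nth.
Qed.

(** Pairing with the mate of a basis vector reads off a coordinate up to sign, which gives
    non-degeneracy. For distinct basis vectors, the bracket of two pairs trivially with the third,
    because the mate of the bracket is one of the two; so each term of the closedness relation
    vanishes. *)
Lemma darboux_symplectic : has_symplectic a.
Proof.
pose f i x : K := coordinate i x.
have wE x y : w x y =
  \sum_(k < (size e)./2) (f k.*2 x * f k.*2.+1 y - f k.*2.+1 x * f k.*2 y) by [].
have half_lt (k : 'I_(size e)./2) : (k.*2 < size e)%N && (k.*2.+1 < size e)%N.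
  by move: (ltn_ord k) e_even; lia.
have w_mate u v : u \in e -> v \in e -> mate (index u e) != index v e -> w u v = 0.
  move=> ue ve uv; rewrite wE big1 // => k _; have /andP [k0 k1] := half_lt k.
  rewrite /f !coordinateE // -!natrM !mulnb.
  have [k2|_] := eqVneq k.*2 (index u e).
    rewrite -k2 /mate odd_double in uv; rewrite (negbTE uv) -k2.
    by rewrite eqn_leq ltnn subrr.
  have [k2|_] := eqVneq k.*2.+1 (index u e); last by rewrite subrr.
  by rewrite -k2 /mate /= odd_double /= in uv; rewrite (negbTE uv) subrr.
pose W : {skew_symmetric a} := w.
exists W.
  apply/eqP/vspaceP => x; rewrite memv0; apply/idP/eqP => [|->]; last exact: mem0v.
  move=> /mem_orthovP x0.
  have fx0 i : (i < size e)%N -> f i x = 0.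
    move=> ie; have mi : (mate i < size e)%N by rewrite /mate; case: ifP => oi; move: ie e_even oi; lia.
    have me : e`_(mate i) \in e by rewrite mem_nth.
    have im : index e`_(mate i) e = mate i.
      by rewrite index_uniq // (free_uniq (basis_free e_basis)).
    have ih : (i./2 < (size e)./2)%N by move: ie e_even; lia.
    have := x0 _ (memvf e`_(mate i)); rewrite /= -/w wE (bigD1 (Ordinal ih)) //= big1.
      move/eqP; rewrite addr0 /f; have /andP [k0 k1] := half_lt (Ordinal ih).
      rewrite !(coordinateE me) // im /mate /=; case: ifP => oi.
        have -> : (i./2.*2.+1 == i.-1) = false by apply/negbTE/eqP; move: oi; lia.
        have -> : i./2.*2 == i.-1 by apply/eqP; move: oi; lia.
        have -> : i./2.*2.+1 = i by move: oi; lia.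
        by rewrite mulr0 mulr1 sub0r oppr_eq0 => /eqP.
      have -> : i./2.*2.+1 == i.+1 by apply/eqP; move: oi; lia.
      have -> : (i./2.*2 == i.+1) = false by apply/negbTE/eqP; move: oi; lia.
      have -> : i./2.*2 = i by move: oi; lia.
      by rewrite mulr0 mulr1 subr0 => /eqP.
    move=> k; rewrite -(inj_eq val_inj) /= => ki; have /andP [k0 k1] := half_lt k.
    rewrite /f !(coordinateE me) // im.
    have -> : (k.*2.+1 == mate i) = false.
      by apply/negbTE/eqP; rewrite /mate; case: ifP => oi; move/eqP: ki; move: oi; lia.
    have -> : (k.*2 == mate i) = false.
      by apply/negbTE/eqP; rewrite /mate; case: ifP => oi; move/eqP: ki; move: oi; lia.
    by rewrite !mulr0 subrr.
  have xe : x \in <<in_tuple e>>%VS by rewrite (span_basis e_basis) memvf.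
  rewrite (coord_span xe) big1 // => i _.
  by rewrite -coordinate_coord -[coordinate i x]/(f i x) fx0 ?scale0r.
pose J x y z := W (lie_br x y) z + W (lie_br y z) x + W (lie_br z x) y.
have Jx x y z : J y z x = J x y z by rewrite /J addrC addrA.
have JD c u v y z : J (c *: u + v) y z = c * J u y z + J v y z.
  rewrite /J lie_brDl lie_brDr lie_brZl lie_brZr.
  by rewrite !linearPl linearDr linearZr_LR /=; ring.
have J0 y z : J 0 y z = 0.
  by have := JD (-1) 0 0 y z; rewrite scaler0 addr0 mulN1r addNr.
have Jxx x y : J x x y = 0.
  by rewrite /J lie_alt linear0l add0r (lie_brC y) linearNl subrr.
(* [J] is invariant under cyclic rotation and linear in its first argument, so each argument is
   rotated to the front and reduced to basis vectors. *)
suff Je : {in e & &, forall x y z, J x y z = 0}.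
  have JP y z : (forall x, x \in e -> J x y z = 0) -> forall x, J x y z = 0.
    move=> Jxe; apply: basis_ind => [|c u v Ju Jv|//]; first exact: J0.
    by rewrite JD Ju Jv mulr0 addr0.
  suff Jall x y z : J x y z = 0 by exact: Jall.
  move: x; apply: (JP y z) => x xe; rewrite -Jx.
  move: y; apply: (JP z x) => y ye; rewrite -Jx.
  move: z; apply: (JP x y) => z ze; rewrite -Jx.
  exact: Je.
have W0 : {in e & &, forall x y z, x != y -> y != z -> z != x -> W (lie_br x y) z = 0}.
  move=> x y z xe ye ze xy yz zx; have [c [u [-> ue hc]]] := e_br xe ye xy.
  rewrite linearZl_LR /=; have [->|/hc mu] := eqVneq c 0; first by rewrite mul0r.
  rewrite [W u z]w_mate ?mulr0 //.
  case: mu => ->.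
    by apply: contraNneq zx => E; rewrite -(nth_index 0 ze) -E nth_index.
  by apply: contraNneq yz => E; rewrite -(nth_index 0 ye) E nth_index.
move=> x y z xe ye ze.
have [->|xy] := eqVneq x y; first exact: Jxx.
have [->|yz] := eqVneq y z; first by rewrite -Jx Jxx.
have [->|zx] := eqVneq z x; first by rewrite Jx Jxx.
by rewrite /J !W0 // !addr0.
Qed.
End DarbouxBasis.

(** * The sum of an abelian algebra and a nilradical *)

Section MatedOrder.
Variables (V : zmodType) (T : finType) (p : T -> V).
Hypothesis p_inj : injective p.
Hypothesis p_torsion : forall (x : T) n, p x *+ n.+1 != 0.
Hypothesis p_opp : forall x y, p x != - p y.

Definition mated_order (l : seq T) : Prop :=
  [/\ uniq l, forall x, x \in l & forall x y z, x != y -> p z = p x + p y ->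
      mate (index z l) = index x l \/ mate (index z l) = index y l].

Let p0 x : p x != 0. Proof. by rewrite -[p x]mulr1n p_torsion. Qed.

Let sum_neql x y z : p z = p x + p y -> x != z.
Proof.
move=> zE; apply: contraNneq (p0 y) => xz; move: zE.
by rewrite xz -{1}[p z]addr0 => /addrI <-.
Qed.

Let sum_neqr x y z : p z = p x + p y -> y != z.
Proof. by rewrite addrC; apply: sum_neql. Qed.

(** The last position has no mate in the list, so [w] must not be the sum of the other two; a sum
    equal to [u] or [v] involves both remaining elements, hence the mate. *)
Let mated3 u v w : uniq [:: u; v; w] -> (forall x, x \in [:: u; v; w]) ->
  p w != p u + p v -> mated_order [:: u; v; w].
Proof.
move=> us ls wuv; split=> // x y z xy zE.
have := us; rewrite /= !inE !negb_or => /andP [/andP [uv uw] /andP [vw _]].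
have xz := sum_neql zE; have yz := sum_neqr zE.
move: xy xz yz zE; have := ls x; have := ls y; have := ls z; rewrite !inE.
case/or3P => /eqP ->; case/or3P => /eqP ->; case/or3P => /eqP ->;
  rewrite ?eqxx // => _ _ _; rewrite /mate /= ?eqxx ?(negbTE uv) ?(negbTE uw) ?(negbTE vw) /=;
  auto => zE.
- by rewrite zE addrC eqxx in wuv.
- by rewrite zE eqxx in wuv.
Qed.

(** The pairs are [u, v] and [w, t]. The only sums that avoid the mate of the result are those of
    one pair giving a member of the other. *)
Let mated4 u v w t : uniq [:: u; v; w; t] -> (forall x, x \in [:: u; v; w; t]) ->
  p u != p w + p t -> p v != p w + p t -> p w != p u + p v -> p t != p u + p v ->
  mated_order [:: u; v; w; t].
Proof.
move=> us ls h1 h2 h3 h4; split=> // x y z xy zE.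
have := us; rewrite /= !inE !negb_or.
move=> /andP [/and3P [uv uw ut] /andP [/andP [vw vt] /andP [wt _]]].
have xz := sum_neql zE; have yz := sum_neqr zE.
move: xy xz yz zE; have := ls x; have := ls y; have := ls z; rewrite !inE.
case/or4P => /eqP ->; case/or4P => /eqP ->; case/or4P => /eqP ->;
  rewrite ?eqxx // => _ _ _; rewrite /mate /= ?eqxx ?(negbTE uv) ?(negbTE uw)
    ?(negbTE ut) ?(negbTE vw) ?(negbTE vt) ?(negbTE wt) /=; auto => zE; exfalso;
  by have zE' := zE; rewrite addrC in zE'; move: h1 h2 h3 h4; rewrite -?zE -?zE' eqxx.
Qed.

Lemma mated_order_exists : (#|T| <= 4)%N -> exists l, mated_order l.
Proof.
move=> T4.
have cover (l : seq T) : uniq l -> (#|T| <= size l)%N -> forall x, x \in l.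
  move=> ul sl x; rewrite cardE in sl.
  have sub : {subset l <= enum T} by move=> y _; rewrite mem_enum.
  by have [_ ->] := uniq_min_size ul sub sl; rewrite mem_enum.
(* This is the pattern of positive roots of type B2: [u], [v], [w = u + v], [t = 2u + v]. Pairing
   [u] with [t] and [v] with [w] works. *)
case: (pselect (exists u v w t, [/\ u != v, p w = p u + p v & p t = p u + p w])).
  move=> [u [v [w [t [uv wE tE]]]]].
  have tE' : p t = p u *+ 2 + p v by rewrite tE wE addrA mulr2n.
  exists [:: u; t; v; w]; have vt : v != t.
    by apply: contraNneq (p_torsion u 1) => vt; rewrite -(inj_eq (addIr (p v))) -tE' vt add0r.
  have us : uniq [:: u; t; v; w].
    rewrite /= !inE !negb_or (sum_neql tE) uv (sum_neql wE) (eq_sym t) vt.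
    by rewrite eq_sym (sum_neqr tE) (sum_neqr wE).
  apply: mated4 => //; first exact: cover.
  - rewrite wE addrCA -{1}[p u]addr0 (inj_eq (addrI _)) eq_sym addr_eq0.
    exact: p_opp.
  - by rewrite tE (inj_eq (addIr _)) (inj_eq p_inj).
  - rewrite tE' addrA -mulrS -{1}[p v]add0r (inj_eq (addIr _)) eq_sym.
    exact: p_torsion.
  - rewrite wE (inj_eq (addrI _)) tE' -{1}[p v]add0r (inj_eq (addIr _)) eq_sym.
    exact: p_torsion.
move=> nochain.
case: (pselect (exists u v w, u != v /\ p w = p u + p v)); last first.
  move=> no; exists (enum T); split=> [|x|x y z xy zE].
  - exact: enum_uniq.
  - by rewrite mem_enum.
  - by case: no; exists x, y, z.
move=> [u [v [w [uv wE]]]].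
(* Without such a chain it suffices to pair one decomposable [w = u + v] with its summand [u]: a sum
   of [v] and the fourth element equal to [u], or of [u] and [w] equal to the fourth, would make a
   chain. *)
have us : uniq [:: u; w; v].
  by rewrite /= !inE !negb_or (sum_neql wE) uv eq_sym (sum_neqr wE).
have vuw : p v != p u + p w.
  rewrite wE addrA -{1}[p v]add0r (inj_eq (addIr _)) -mulr2n eq_sym.
  exact: p_torsion.
have [T3|T3] := leqP #|T| 3.
  by exists [:: u; w; v]; apply: mated3 => //; apply: cover.
have /card_gt0P [t] : (0 < #|[predC [:: u; w; v]]|)%N.
  by rewrite -(ltn_add2l #|[:: u; w; v]|) addn0 cardC (card_uniqP us).
rewrite inE => tn; have {}tn : t \notin [:: u; w; v] by []; exists [:: u; w; v; t].
have ut : uniq [:: u; w; v; t] by rewrite -[[:: u; w; v; t]]/(rcons [:: u; w; v] t) rcons_uniq tn us.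
have [tu vt] : t != u /\ v != t.
  by move: tn; rewrite !inE !negb_or (eq_sym v) => /and3P [].
apply: mated4 => //; first exact: cover.
- by apply/eqP => uE; apply: nochain; exists v, t, u, w; split=> //; rewrite wE addrC.
- by rewrite wE addrC (inj_eq (addrI _)) (inj_eq p_inj) eq_sym.
- by apply/eqP => tE; apply: nochain; exists u, v, w, t.
Qed.

End MatedOrder.

(** * Existence and non-existence of symplectic forms *)

Section Nilradical.
Variables (F K : numFieldType) (iota : {rmorphism F -> K}).
Variables (g : lieAlg K) (h : {vspace g}) (D : {fset dual_space h}) (X : D -> g).
Variables (c : D -> D -> D -> F) (n : lieAlg F) (x : D -> n) (B : g -> g -> K^o) (s : nat).
Hypothesis h_cartan : is_cartan h.
Hypothesis D_pos : is_positive_system D.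
Hypothesis X_span : forall (a : D) (y : g), in_root_space (val a) y <-> y \in <[X a]>%VS.
Hypothesis X_br : forall d e, lie_br (X d) (X e) = \sum_f iota (c d e f) *: X f.
Hypothesis x_basis : basis_of {:n} (codom x).
Hypothesis x_br : forall d e, lie_br (x d) (x e) = \sum_f c d e f *: x f.
Hypothesis B_inv : invariant_form B.
Local Notation a := (dsum_lie (abelian_lie F s) n).

Let inr (y : n) : a := (0, y).
Let inl (r : 'rV[F]_s) : a := (r, 0).
Let v d := inr (x d).

Let inrP k y z : inr (k *: y + z) = k *: inr y + inr z.
Proof.
have e0 : k *: (0 : 'rV[F]_s) + 0 = 0 by rewrite scaler0 addr0.
by rewrite /inr -{1}e0.
Qed.

Let inr0 : inr 0 = 0. Proof. by []. Qed.

Let inlP k r t : inl (k *: r + t) = k *: inl r + inl t.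
Proof.
have e0 : k *: (0 : n) + 0 = 0 by rewrite scaler0 addr0.
by rewrite /inl -{1}e0.
Qed.

Let inlr r y : (r, y) = inl r + inr y :> a.
Proof. by rewrite -{1}[r]addr0 -{1}[y]add0r. Qed.

Let br_inl r z : lie_br (inl r) z = 0.
Proof. by congr pair; rewrite /= lie_br0l. Qed.

Let v_br d e : lie_br (v d) (v e) = \sum_f c d e f *: v f.
Proof.
transitivity (inr (lie_br (x d) (x e))) => //.
rewrite x_br; elim/big_rec2: _ => // f y z _ <-.
by rewrite inrP.
Qed.

Let v_neq0 d : v d != 0.
Proof.
have : x d != 0 by apply: (free_not0 (basis_free x_basis)); apply: codom_f.
by apply: contraNneq => -[->].
Qed.

Lemma nilradical_sum_symplectic : (\dim {:g} <= 10)%N -> ~~ odd (\dim {:a}) -> has_symplectic a.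
Proof.
move=> dimg even_a.
have D4 : (#|{: D}| <= 4)%N.
  have [//|D5] := leqP #|{: D}| 4.
  have /card_gt0P [d0 _] : (0 < #|{: D}|)%N by apply: leq_trans D5.
  have := card_positive_roots h_cartan D_pos X_span B_inv d0; lia.
have [] := @mated_order_exists _ D val _ _ _ D4.
- exact: val_inj.
- move=> d m; rewrite -scaler_nat scaler_eq0 pnatr_eq0 /=.
  exact: D_neq0 D_pos d.
- exact: D_opp D_pos.
move=> l [l_uniq lD l_mate].
(* Root vectors come first, so their positions, and hence their mates, are those in [l]. The abelian
   vectors follow and only take part in zero brackets. *)
pose e : seq a := map v l ++ [seq inl (delta_mx 0 i) | i <- enum 'I_s].
have in_v d : v d \in e by rewrite mem_cat map_f.
have in_inl i : inl (delta_mx 0 i) \in e.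
  by rewrite mem_cat; apply/orP; right; apply/mapP; exists i; rewrite ?mem_enum.
have e_basis : basis_of fullv e.
  rewrite basisEdim; apply/andP; split.
    apply/subvP => -[r y] _; rewrite inlr memvD //.
      rewrite (row_sum_delta r); elim/big_ind: _ => [|u1 u2 m1 m2|i _].
      - exact: mem0v.
      - by rewrite -[u1]scale1r inlP scale1r memvD.
      - by rewrite -[_ *: _]addr0 inlP memvD ?mem0v // memvZ // memv_span.
    elim/(basis_ind x_basis): y => [|k u w mu mw|u /codomP [d ->]].
    - exact: mem0v.
    - by rewrite inrP memvD ?memvZ.
    - exact/memv_span/in_v.
  have -> : \dim {:a} = (s + \dim {:n})%N by rewrite !dimvf -[s in RHS]mul1n.
  rewrite -(span_basis x_basis) (eqP (basis_free x_basis)) size_codom.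
  rewrite size_cat 2!size_map size_enum_ord addnC leq_add2l.
  by rewrite -(card_uniqP l_uniq) max_card.
have v_inj : injective v.
  move=> d1 d2 [/eqP]; have := free_uniq (basis_free x_basis).
  by rewrite /codom /image_mem => /injectiveP xi /eqP /xi.
have index_v d : index (v d) e = index d l.
  by rewrite index_cat map_f // index_map.
apply: (darboux_symplectic e_basis).
  by have := eqP (basis_free e_basis); rewrite (span_basis e_basis) => <-.
move=> u w; rewrite !mem_cat.
have zero : lie_br u w = 0 -> u \in e -> exists c0 w0, [/\ lie_br u w = c0 *: w0,
  w0 \in e & c0 != 0 -> mate (index w0 e) = index u e \/ mate (index w0 e) = index w e].
  by move=> uw ue; exists 0, u; rewrite uw scale0r eqxx.
case/orP => [/mapP [d dl uE]|/mapP [i _ uE]]; last first.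
  move=> _ _; apply: zero; first by rewrite uE br_inl.
  by rewrite uE.
case/orP => [/mapP [d' dl' wE]|/mapP [i _ wE]]; last first.
  move=> _; apply: zero; first by rewrite wE lie_brC br_inl oppr0.
  by rewrite uE.
move=> uw; have [br0|] := eqVneq (lie_br (X d) (X d')) 0.
  apply: zero; last by rewrite uE.
  by rewrite uE wE (v_br_eq0 D_pos X_span X_br v_br).
move=> /(D_add D_pos X_span) [f fE].
have [vE _] := br_sum D_pos X_span X_br v_br fE.
exists (c d d' f), (v f); rewrite {1}uE {1}wE vE; split=> // _.
rewrite uE wE !index_v; apply: l_mate => //.
by apply: contraNneq uw; rewrite uE wE => ->.
Qed.

Hypothesis ad_rank : forall (y : g) (W : {vspace g}),
  y != 0 -> (forall z, lie_br z y \in W) -> (4 < \dim W)%N.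

(** Without roots every weight is zero, so [g] equals [h] and is abelian, against the rank
    hypothesis. *)
Lemma positive_root_exists (y : g) : y != 0 -> exists d : D, True.
Proof.
move=> y0; apply: contrapT => no.
have all_h z : z \in h.
  have [l [-> lw]] := weight_decomposition h_cartan z.
  rewrite big_seq; apply: memv_suml => u /lw [b hu].
  have [->|u0] := eqVneq u 0; first exact: mem0v.
  have [b0|b0] := eqVneq b 0; first by apply: (wt0_cartan h_cartan); rewrite -b0.
  by case: (wt_root D_pos hu u0 b0) => -[d _]; case: no; exists d.
have [ab _ _] := h_cartan.
suff : (4 < \dim (0%VS : {vspace g}))%N by rewrite dimv0.
by apply: (ad_rank y0) => z; rewrite ab // mem0v.
Qed.

Lemma nilradical_sum_not_symplectic (y : g) : y != 0 -> ~ has_symplectic a.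
Proof.
move=> /positive_root_exists [d0 _] [w nondeg w_closed].
have [q [L qL]] := highest_root_level_exists d0 h_cartan D_pos X_span B_inv ad_rank.
have wZ k u z : w u (k *: z) = k * w u z by rewrite linearZr_LR.
have wD u y1 y2 : w u (y1 + y2) = w u y1 + w u y2 by rewrite linearDr.
have wC u z : w u z = - w z u by rewrite hermC expr1 mulN1r.
have [d1 [d2 d12]] := level_nonempty qL.
case/negP: (v_neq0 q); rewrite -memv0 -(eqP nondeg); apply/mem_orthovP => -[r z] _.
rewrite inlr wD.
(* Abelian vectors commute with both root vectors whose bracket is a multiple of [v q]. *)
have -> : w (v q) (inl r) = 0.
  apply: (w_commuting D_pos X_span X_br v_br qL wZ wC w_closed d12);
    by rewrite lie_brC br_inl oppr0.
rewrite add0r; elim/(basis_ind x_basis): z => [|k u1 u2 h1 h2|u /codomP [d ->]].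
- by rewrite inr0 linear0r.
- by rewrite inrP wD wZ h1 h2 mulr0 addr0.
- exact: (w_root_vector D_pos X_span X_br v_br qL wZ wC w_closed (v_neq0 q)).
Qed.

End Nilradical.

(** * Trace forms and ranks of adjoint maps of matrix algebras *)

Lemma dim_leq_ker (K : fieldType) (V1 V2 : vectType K) (phi : V1 -> V2)
    (U : {vspace V1}) (W : {vspace V2}) :
  linear phi -> (forall u, phi u \in W) -> (forall u, phi u = 0 -> u \in U) ->
  (\dim {:V1} <= \dim W + \dim U)%N.
Proof.
move=> phi_lin phiW phiU.
pose f : {linear V1 -> V2} := HB.pack phi (GRing.isLinear.Build K V1 V2 *:%R phi phi_lin).
rewrite -(limg_ker_dim (linfun f) fullv) addnC leq_add //.
  by apply: dimvS; apply/subvP => _ /memv_imgP [u _ ->]; rewrite lfunE.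
rewrite capfv; apply: dimvS; apply/subvP => u; rewrite memv_ker lfunE => /eqP.
exact: phiU.
Qed.

(** The bound 5 is what yields three elements of [L], since [ad (X q)] has rank at most
    [2 + #|L|]. *)
Definition ad_rank_ge5 (K : fieldType) (g : lieAlg K) : Prop :=
  forall (x : g) (W : {vspace g}), x != 0 -> (forall z, lie_br z x \in W) -> (4 < \dim W)%N.

(** * Transport along isomorphisms and restriction to subalgebras *)

Section Transport.
Variables (K : fieldType) (g1 g2 : lieAlg K).
Hypothesis iso : lie_iso g1 g2.

Lemma lie_iso_dim : (\dim {:g1} <= \dim {:g2})%N.
Proof.
have [f [[f' fK _] _]] := iso.
suff : (\dim {:g1} <= \dim {:g2} + \dim (0 : {vspace g1})%VS)%N by rewrite dimv0 addn0.
apply: (@dim_leq_ker _ _ _ f) => [|u|u fu0]; rewrite ?memvf ?memv0 //; first exact: linearP.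
by rewrite -(inj_eq (can_inj fK)) fu0 raddf0.
Qed.

Lemma lie_iso_nontrivial (y : g2) : y != 0 -> exists x : g1, x != 0.
Proof.
have [f [[f' _ f'K] _]] := iso => y0; exists (f' y).
by apply: contraNneq y0 => x0; rewrite -(f'K y) x0 raddf0.
Qed.

Lemma lie_iso_form (B : g2 -> g2 -> K^o) :
  invariant_form B -> exists B1 : g1 -> g1 -> K^o, invariant_form B1.
Proof.
have [f [[f' fK f'K] fbr]] := iso; move=> [Bl BC Bi Bn].
exists (fun x y => B (f x) (f y)); split=> [x c u v|x y|x y z|x x0].
- by rewrite linearP Bl.
- exact: BC.
- by rewrite !fbr.
- have [|y By] := Bn (f x); last by exists (f' y); rewrite f'K.
  by apply: contraNneq x0 => fx; rewrite -(fK x) fx -(raddf0 f) fK.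
Qed.

Lemma lie_iso_ad_rank : ad_rank_ge5 g2 -> ad_rank_ge5 g1.
Proof.
have [f [[f' fK f'K] fbr]] := iso; move=> rk x W x0 brW.
have fx : f x != 0 by apply: contraNneq x0 => fx; rewrite -(fK x) fx -(raddf0 f) fK.
apply: leq_trans (rk (f x) (linfun f @: W)%VS fx _) _ => [z|].
  rewrite -(f'K z) -fbr; have <- := lfunE f; exact/memv_img/brW.
by rewrite -[X in (_ <= X)%N](limg_ker_dim (linfun f)) leq_addl.
Qed.

End Transport.

Lemma sub_ad_rank (K : fieldType) (g : lieAlg K) (U : {vspace g})
    (U_br : forall x y, x \in U -> y \in U -> lie_br x y \in U) :
  (forall (x : g) (W : {vspace g}), x \in U -> x != 0 ->
    (forall z, z \in U -> lie_br z x \in W) -> (4 < \dim W)%N) ->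
  ad_rank_ge5 (sub_lie U_br).
Proof.
move=> rk x W x0 brW; pose f := linfun (@vsval _ _ U).
apply: leq_trans (rk (vsval x) (f @: W)%VS (subvsP x) _ _) _ => [|z zU|].
- by rewrite -(raddf0 (@vsval _ _ U)) (inj_eq val_inj).
- have -> : lie_br z (vsval x) = f (lie_br (Subvs zU : sub_lie U_br) x) by rewrite lfunE.
  exact/memv_img/brW.
- by rewrite -[X in (_ <= X)%N](limg_ker_dim f) leq_addl.
Qed.

Lemma dim_subvs (K : fieldType) (V : vectType K) (U : {vspace V}) :
  \dim {: subvs_of U} = \dim U.
Proof. by rewrite dimvf. Qed.

Lemma dim_col (K : fieldType) (m : nat) : \dim {: 'cV[K]_m} = m.
Proof. by rewrite dimvf -[RHS]muln1. Qed.

(** * Linear algebra of matrices and the trace form *)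

Section MatrixLemmas.
Variables (K : numFieldType) (m : nat).
Implicit Types (A X M : 'M[K]_m) (u v w y : 'cV[K]_m).

(** If every vector is an eigenvector, then testing the sum of two standard basis vectors shows that
    their eigenvalues agree, so [X] is scalar. *)
Lemma nonscalar_vector X : (forall c, X != c%:M) -> exists v, forall c, X *m v != c *: v.
Proof.
move=> nonscal; apply: contrapT => no.
have ev v : exists c, X *m v = c *: v.
  apply: contrapT => nov; apply: no; exists v => c.
  by apply/eqP => e; apply: nov; exists c.
case: m X nonscal ev {no} => [|n] X nonscal ev.
  by case/eqP: (nonscal 0); apply/matrixP => -[].
have /choice [c cP] : forall i : 'I_n.+1, exists c, X *m delta_mx i 0 = c *: delta_mx i (0 : 'I_1).
  by move=> i; apply: ev.
have Xd i j : X i j = (X *m delta_mx j (0 : 'I_1)) i 0 by rewrite -colE mxE.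
have cE i : c i = c 0.
  have [->//|i0] := eqVneq i 0.
  have [k] := ev (delta_mx i 0 + delta_mx 0 0).
  rewrite mulmxDr !cP scalerDr => /matrixP e.
  have := e i 0; have := e 0 0; rewrite !mxE !eqxx (negbTE i0) eq_sym (negbTE i0) /=.
  by rewrite !mulr1 !mulr0 !addr0 !add0r => -> ->.
case/eqP: (nonscal (c 0)); apply/matrixP => i j; rewrite Xd cP !mxE eqxx andbT cE.
by rewrite mulr_natr.
Qed.

Lemma separating_functional v w : (forall c, w != c *: v) ->
  exists y, y^T *m v = 0 /\ y^T *m w = 1%:M.
Proof.
move=> wv; have : ~~ (w^T <= v^T)%MS.
  apply/negP => /sub_rVP [c e]; case/eqP: (wv c).
  by rewrite -[w]trmxK e linearZ /= trmxK.
rewrite submxE => /eqP wc.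
have [j wj] : exists j, w^T *m (cokermx v^T *m delta_mx j (0 : 'I_1)) != 0.
  apply: contrapT => no; apply: wc; apply/matrixP => i j; rewrite [RHS]mxE.
  apply: contrapT => ij; apply: no; exists j; apply/eqP => /matrixP /(_ i 0).
  by rewrite mulmxA -colE mxE [RHS]mxE.
pose y := cokermx v^T *m delta_mx j (0 : 'I_1); pose k := (w^T *m y) 0 0.
have k0 : k != 0.
  by apply: contraNneq wj => k0; rewrite [w^T *m _]mx11_scalar -/y -/k k0 raddf0.
have wy : y^T *m w = k%:M.
  by apply: trmx_inj; rewrite trmx_mul trmxK [LHS]mx11_scalar tr_scalar_mx.
have vy : y^T *m v = 0.
  by apply: trmx_inj; rewrite trmx_mul trmxK trmx0 mulmxA mulmx_coker mul0mx.
exists (k^-1 *: y); rewrite linearZ /= -!scalemxAl wy vy scaler0; split=> //.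
by rewrite scale_scalar_mx mulVf.
Qed.

Lemma trace_form_nondegenerate A : A != 0 -> exists M, \tr (A *m M) != 0.
Proof.
move=> A0; have [i [j Aij]] : exists i j, A i j != 0.
  apply: contrapT => no; case/eqP: A0; apply/matrixP => i j; rewrite mxE.
  by apply: contrapT => /eqP Aij; apply: no; exists i, j.
exists (delta_mx j i); rewrite /mxtrace (bigD1 i) //= big1 => [|k ki].
  rewrite addr0 mxE (bigD1 j) //= big1 ?addr0 => [|l lj]; first by rewrite mxE !eqxx mulr1.
  by rewrite mxE (negbTE lj) mulr0.
by rewrite mxE big1 // => l _; rewrite mxE (negbTE ki) andbF mulr0.
Qed.

Definition trace_form (U : {vspace gl_lie K m}) (x y : subvs_of U) : K^o :=
  \tr ((vsval x : 'M[K]_m) *m vsval y).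

Lemma trace_form_invariant (U : {vspace gl_lie K m})
    (U_br : forall x y : gl_lie K m, x \in U -> y \in U -> lie_br x y \in U) :
  (forall A, A \in U -> A != 0 -> exists2 M, M \in U & \tr (A *m M) != 0) ->
  @invariant_form K (sub_lie U_br) (@trace_form U).
Proof.
move=> nondeg; split=> [x c u v|x y|x y z|x x0].
- by rewrite /trace_form !linearP.
- exact: mxtrace_mulC.
- rewrite /trace_form /= /gl_br mulmxBl mulmxBr !raddfB /= mulmxA; congr (_ - _).
  by rewrite -mulmxA mxtrace_mulC mulmxA.
have [||M MU AM] := nondeg (vsval x); first exact: subvsP.
  by rewrite -(raddf0 (@vsval _ _ U)) (inj_eq val_inj).
by exists (Subvs MU).
Qed.

End MatrixLemmas.

(** * The special linear algebras *)

Section SpecialLinear.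
Variables (K : numFieldType) (n : nat).
Local Notation m := n.+1.
Implicit Types (A X M : 'M[K]_m).

Lemma traceless_part M : M - (\tr M / m%:R)%:M \in sl_space K m.
Proof.
by rewrite sl_spaceE raddfB /= mxtrace_scalar -[_ / _ *+ _]mulr_natr divfK ?subrr // pnatr_eq0.
Qed.

Lemma sl_form_invariant :
  @invariant_form K (sl_lie K m) (@trace_form K m (sl_space K m)).
Proof.
apply: trace_form_invariant => A; rewrite sl_spaceE => /eqP trA.
move=> /trace_form_nondegenerate [M AM].
exists (M - (\tr M / m%:R)%:M); first exact: traceless_part.
by rewrite mulmxBr raddfB /= mul_mx_scalar linearZ /= trA mulr0 subr0.
Qed.

Lemma sl_dim : (\dim {: sl_lie K m} <= m * m)%N.
Proof.
rewrite dim_subvs; apply: leq_trans (dimvS (subvf _)) _.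
by rewrite dimvf.
Qed.

Lemma sl_ad_rank : (3 <= n)%N -> ad_rank_ge5 (sl_lie K m).
Proof.
move=> n3; apply: sub_ad_rank => X W; rewrite sl_spaceE => /eqP trX X0 slW.
have glW M : M *m X - X *m M \in W.
  have := slW _ (traceless_part M); rewrite /= /gl_br mulmxBl mulmxBr.
  by rewrite mul_scalar_mx mul_mx_scalar opprD addrACA -opprD subrr subr0.
have [|v vP] := @nonscalar_vector K m X.
  move=> c; apply: contraNneq X0 => Xc; move: trX; rewrite Xc mxtrace_scalar => /eqP.
  by rewrite mulrn_eq0 /= => /eqP ->; rewrite raddf0.
(* [ad X] is restricted to the matrices [u *m f + v *m g], with [2 m] parameters. Its kernel there
   lies in the plane [U], so the rank is at least [2 m - 2], which is at least 6. *)
have [y [fv fXv]] := separating_functional vP.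
pose f := y^T; pose c := (f *m X *m (X *m v)) 0 0.
pose phi (p : 'cV[K]_m * 'rV[K]_m) : 'M[K]_m :=
  (p.1 *m f + v *m p.2) *m X - X *m (p.1 *m f + v *m p.2).
pose U : {vspace ('cV[K]_m * 'rV[K]_m)%type} :=
  (<[(v, - f)]> + <[(X *m v, f *m X - c *: f)]>)%VS.
have phi_lin : linear phi.
  move=> k [u g] [u' g']; pose b u g := u *m f + v *m g.
  have bP : b (k *: u + u') (k *: g + g') = k *: b u g + b u' g'.
    by rewrite /b mulmxDl mulmxDr -scalemxAl -scalemxAr scalerDr addrACA.
  have phiE u1 g1 : phi (u1, g1) = b u1 g1 *m X - X *m b u1 g1 by [].
  rewrite !phiE [LHS](phiE (k *: u + u') (k *: g + g')) bP.
  move: (b u g) (b u' g') => M1 M2.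
  by rewrite mulmxDl mulmxDr -scalemxAl -scalemxAr scalerBr opprD addrACA.
have phiU p : phi p = 0 -> p \in U.
  case: p => u g; rewrite /phi /= => /eqP; rewrite subr_eq0 => /eqP e.
  pose al := (g *m v) 0 0; pose be := (g *m (X *m v)) 0 0.
  have gv : g *m v = al%:M by rewrite [LHS]mx11_scalar.
  have gXv : g *m (X *m v) = be%:M by rewrite [LHS]mx11_scalar.
  (* Multiplying the commutation relation by [v] on the right determines [u]; multiplying it by [f]
     on the left determines [g]. Both depend only on [al] and [be]. *)
  have uE : u = al *: (X *m v) - be *: v.
    have := congr1 (mulmx^~ v) e; rewrite /= -!(mulmxA _ _ v) !mulmxDl -!mulmxA.
    rewrite fXv gXv fv gv mulmx0 mulmx1 add0r !mul_mx_scalar -scalemxAr => <-.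
    by rewrite addrK.
  have fu : f *m u = al%:M.
    by rewrite uE mulmxBr -!scalemxAr fXv fv scaler0 subr0 scale_scalar_mx mulr1.
  have fXu : f *m (X *m u) = (al * c - be)%:M.
    rewrite uE !mulmxBr -!scalemxAr (mulmxA f X) [f *m X *m _]mx11_scalar -/c fXv.
    by rewrite !scale_scalar_mx mulr1 raddfB.
  have gE : g = al *: (f *m X - c *: f) + be *: f.
    have := congr1 (mulmx f) e; rewrite /= (mulmxA f _ X) (mulmxA f X) !mulmxDr.
    rewrite !mulmxA fu fv mul0mx addr0 -(mulmxA f X u) -(mulmxA f X v) fXu fXv mul1mx.
    rewrite !mul_scalar_mx => e2.
    have -> : g = al *: f *m X - (al * c - be) *: f by rewrite e2 addrAC subrr add0r.
    by rewrite scalerBl opprB scalerBr scalerA -scalemxAl addrA [RHS]addrAC.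
  have -> : (u, g) = - be *: (v, - f) + al *: (X *m v, f *m X - c *: f).
    by congr pair; rewrite /= ?uE ?gE addrC ?scaleNr ?scalerN ?opprK.
  by rewrite memv_add ?memvZ ?memv_line.
have phiW p : phi p \in W by apply: glW.
have := dim_leq_ker phi_lin phiW phiU.
have -> : \dim {: ('cV[K]_m * 'rV[K]_m)%type} = (m + m)%N.
  by rewrite dimvf -[X in (X + _)%N]muln1 -[X in (_ + X)%N]mul1n.
have : (\dim U <= 2)%N.
  by apply: leq_trans (dimv_add_leqif _ _).1 _; rewrite !dim_vline (leq_add (leq_b1 _) (leq_b1 _)).
by move: (\dim W) (\dim U) n3 => w u; lia.
Qed.

End SpecialLinear.

(** * Algebras preserving a symmetric or alternating form *)

Section Isometries.
Variables (K : numFieldType) (m : nat) (J : 'M[K]_m) (eps : K).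
Hypothesis J_sym : J^T = eps *: J.
Hypothesis eps2 : eps * eps = 1.
Hypothesis J_unit : J \in unitmx.
Implicit Types (A X M : 'M[K]_m) (u v w y : 'cV[K]_m).

Let isomP X : X \in isom_space J -> J *m X = - (X^T *m J).
Proof. by rewrite isom_spaceE addrC addr_eq0 => /eqP. Qed.

Let invJ_tr : (invmx J)^T *m J = eps%:M.
Proof.
have JE : J = eps *: J^T by rewrite J_sym scalerA eps2 scale1r.
by rewrite {2}JE -scalemxAr -trmx_mul mulmxV // trmx1 scalemx1.
Qed.

Lemma isom_form_invariant :
  @invariant_form K (isom_lie J) (@trace_form K m (isom_space J)).
Proof.
apply: trace_form_invariant => A /isomP JA /trace_form_nondegenerate [M AM].
have A_adj : (invmx J)^T *m (A^T *m J^T) = - A.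
  rewrite J_sym -!scalemxAr -[A^T *m J]opprK -JA mulmxN mulmxA invJ_tr mul_scalar_mx.
  by rewrite scalerN scalerA eps2 scale1r.
(* [P] is the adjoint of [M] for [J]. Then [M - P] is an infinitesimal isometry, and its trace
   against [A] is twice that of [M]. *)
pose P := invmx J *m M^T *m J.
have PJ : P^T *m J = J *m M.
  rewrite /P !trmx_mul trmxK -!mulmxA invJ_tr mul_mx_scalar J_sym -scalemxAr -scalemxAl.
  by rewrite scalerA eps2 scale1r.
have JP : J *m P = M^T *m J by rewrite /P !mulmxA mulmxV // mul1mx.
have trP : \tr (A *m P) = - \tr (A *m M).
  rewrite -mxtrace_tr trmx_mul /P !trmx_mul trmxK -mulmxA mxtrace_mulC -!mulmxA A_adj.
  by rewrite mulmxN raddfN /= mxtrace_mulC.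
exists (M - P); first by rewrite isom_spaceE linearB /= mulmxBl mulmxBr PJ JP addrA subrK subrr.
by rewrite mulmxBr raddfB /= trP opprK -mulr2n mulrn_eq0.
Qed.

Lemma isom_ad_rank X (W : {vspace 'M[K]_m}) : X \in isom_space J -> X != 0 ->
  (forall M, M \in isom_space J -> M *m X - X *m M \in W) ->
  (m <= \dim W + 2)%N /\ (eps = -1 -> (m <= \dim W + 1)%N).
Proof.
move=> /isomP JX X0 XW.
have [|v vP] := @nonscalar_vector K m X.
  move=> c; apply: contraNneq X0 => Xc; move: JX; rewrite Xc tr_scalar_mx.
  rewrite mul_mx_scalar mul_scalar_mx => /eqP; rewrite -addr_eq0 -scalerDl => /eqP cJ.
  have /eqP : (c + c)%:M = 0 :> 'M[K]_m by rewrite -scalemx1 -(mulmxV J_unit) scalemxAl cJ mul0mx.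
  by rewrite raddfD /= -mulr2n -scaler_nat scaler_eq0 pnatr_eq0.
have [y [vy Xvy]] := separating_functional vP.
have {}vy : v^T *m y = 0 by apply: trmx_inj; rewrite trmx_mul trmxK vy trmx0.
have {}Xvy : (X *m v)^T *m y = 1%:M by apply: trmx_inj; rewrite trmx_mul trmxK Xvy trmx1.
(* These isometries of rank at most two are parametrized by one vector [u]. The kernel of [u |->
   [b u, X]] lies in the span of [v] and [X *m v], which costs at most two dimensions. *)
pose b u := u *m (v^T *m J) - eps *: (v *m (u^T *m J)).
pose phi u := b u *m X - X *m b u.
have b_lin : linear b.
  move=> k u1 u2; have e : (k *: u1 + u2)^T = k *: u1^T + u2^T by rewrite linearP.
  rewrite /b e !mulmxDl mulmxDr -!scalemxAl -!scalemxAr.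
  by rewrite scalerDr scalerBr opprD addrACA !scalerA [k * eps]mulrC.
have phi_lin : linear phi.
  move=> k u1 u2; rewrite /phi b_lin; move: (b u1) (b u2) => M1 M2.
  by rewrite mulmxDl mulmxDr -scalemxAl -scalemxAr scalerBr opprD addrACA.
have b_isom u : b u \in isom_space J.
  rewrite isom_spaceE /b linearB linearZ /= !trmx_mul !trmxK J_sym -!scalemxAl scalerA eps2.
  by rewrite scale1r mulmxBl mulmxBr -scalemxAl -scalemxAr !mulmxA addrA subrK subrr.
have phiW u : phi u \in W by apply: XW.
have phi_y u : phi u = 0 -> u = eps *: (((X *m u)^T *m y) 0 0 *: v + (u^T *m y) 0 0 *: (X *m v)).
  move=> phi0.
  (* Commutation of [b u] with [X], rewritten by [J *m X = - (X^T *m J)] and with the invertible [J]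
     cancelled on the right. Applying it to [y] isolates [u]. *)
  have S0 : eps *: (v *m (X *m u)^T + X *m v *m u^T) - (u *m (X *m v)^T + X *m u *m v^T) = 0.
    rewrite -[LHS](mulmxK J_unit) -[RHS](mul0mx _ (invmx J)); congr (_ *m _).
    rewrite -[RHS]phi0.
    have t1 u1 u2 : u1 *m (u2^T *m J) *m X = - (u1 *m (X *m u2)^T *m J).
      by rewrite -!mulmxA JX !mulmxN trmx_mul !mulmxA.
    have t2 u1 u2 : X *m (u1 *m (u2^T *m J)) = X *m u1 *m u2^T *m J by rewrite !mulmxA.
    rewrite /phi /b !mulmxBl !mulmxBr -!scalemxAl -!scalemxAr !t1 !t2 !mulmxDl.
    by rewrite scalerN opprK scalerDr opprD opprB [X in _ = X + _]addrC [RHS]addrACA.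
  have := congr1 (mulmx^~ y) S0; rewrite /= mul0mx mulmxBl -scalemxAl !mulmxDl -!mulmxA.
  rewrite vy Xvy !mulmx0 addr0 mulmx1 => /eqP; rewrite subr_eq0 => /eqP e.
  set k1 := ((X *m u)^T *m y) 0 0; set k2 := (u^T *m y) 0 0.
  move: e; rewrite [(X *m u)^T *m y]mx11_scalar -/k1 [u^T *m y]mx11_scalar -/k2.
  by rewrite !mul_mx_scalar -(scalemxAr k2) => /esym.
pose U := (<[v]> + <[X *m v]>)%VS.
have phiU u : phi u = 0 -> u \in U.
  by move=> /phi_y ->; rewrite memvZ // memv_add // memvZ // memv_line.
have dimU : (\dim U <= 2)%N.
  by apply: leq_trans (dimv_add_leqif _ _).1 _; rewrite !dim_vline (leq_add (leq_b1 _) (leq_b1 _)).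
have := dim_leq_ker phi_lin phiW phiU; rewrite dim_col => dimW.
split=> [|epsN]; first by apply: leq_trans dimW _; rewrite leq_add2l.
pose f : {linear 'cV[K]_m -> 'M[K]_m} :=
  HB.pack phi (GRing.isLinear.Build K 'cV[K]_m 'M[K]_m *:%R phi phi_lin).
(* In the alternating case [v] is not in the kernel, since [phi_y] would give [v = - v]. The kernel
   is thus a proper subspace of [U], which saves one dimension. *)
pose N := lker (linfun f).
have NP u : (u \in N) = (phi u == 0) by rewrite memv_ker lfunE.
have phiN u : phi u = 0 -> u \in N by rewrite NP => ->.
have := dim_leq_ker phi_lin phiW phiN; rewrite dim_col => /leq_trans; apply.
rewrite leq_add2l -ltnS; apply: leq_trans dimU.
have NU : (N <= U)%VS by apply/subvP => u; rewrite NP => /eqP /phiU.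
rewrite ltn_neqAle (dimv_leqif_eq NU).2 dimvS // andbT.
apply: contraTneq (vP 0) => NE.
have : v \in N by rewrite NE -[v]addr0 memv_add ?memv_line ?mem0v.
rewrite NP => /eqP /phi_y; rewrite Xvy vy !mxE eqxx mulr1n scale1r !scale0r addr0 epsN scaleN1r.
move=> /eqP; rewrite -addr_eq0 -mulr2n -scaler_nat scaler_eq0 pnatr_eq0 /= => /eqP ->.
by rewrite mulmx0 eqxx.
Qed.

End Isometries.

(** * The classical families *)

Section ClassicalAlgebras.
Variable K : numFieldType.

Lemma sl_nontrivial (n : nat) : (1 <= n)%N -> exists x : sl_lie K n.+1, x != 0.
Proof.
case: n => // n _; pose A : 'M[K]_n.+2 := delta_mx 0 (lift 0 0).
have Asl : A \in sl_space K n.+2.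
  rewrite sl_spaceE /mxtrace big1 // => i _; rewrite mxE.
  by have [->|] := eqVneq i 0; rewrite ?andFb.
exists (Subvs Asl); apply/eqP => /(congr1 val) /matrixP /(_ 0 (lift 0 0)).
by rewrite !mxE !eqxx => /eqP; rewrite oner_eq0.
Qed.

Lemma so_form_invariant (m : nat) :
  @invariant_form K (so_lie K m) (@trace_form K m (isom_space 1%:M)).
Proof.
apply: (@isom_form_invariant _ _ _ 1); rewrite ?trmx1 ?scale1r ?mulr1 //.
exact: unitmx1.
Qed.

Lemma so_ad_rank (m : nat) : (7 <= m)%N -> ad_rank_ge5 (so_lie K m).
Proof.
move=> m7; apply: sub_ad_rank => X W XU X0 XW.
have [|||dimW _] := @isom_ad_rank K m 1%:M 1 _ _ _ X W XU X0 XW.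
- by rewrite trmx1 scale1r.
- by rewrite mulr1.
- exact: unitmx1.
- by move: (\dim W) m7 dimW => w; lia.
Qed.

Lemma so_nontrivial (m : nat) : (2 <= m)%N -> exists x : so_lie K m, x != 0.
Proof.
case: m => [|[|m]] // _; pose A : 'M[K]_m.+2 := delta_mx 0 (lift 0 0) - delta_mx (lift 0 0) 0.
have Aso : A \in isom_space (1%:M : 'M[K]_m.+2).
  by rewrite isom_spaceE mulmx1 mul1mx /A linearB /= !trmx_delta addrA subrK subrr.
exists (Subvs Aso); apply/eqP => /(congr1 val) /matrixP /(_ 0 (lift 0 0)).
by rewrite !mxE !eqxx subr0 => /eqP; rewrite oner_eq0.
Qed.

(** A skew-symmetric matrix is determined by its ten entries above the diagonal, listed in [L]. *)
Lemma so5_dim : (\dim {: so_lie K 5} <= 10)%N.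
Proof.
pose L : seq (nat * nat) :=
  [:: (0, 1); (0, 2); (0, 3); (0, 4); (1, 2); (1, 3); (1, 4); (2, 3); (2, 4); (3, 4)]%N.
pose phi (A : so_lie K 5) : 'rV[K]_10 :=
  \row_(k < 10) (vsval A : 'M[K]_5) (inord (nth (0, 0)%N L k).1) (inord (nth (0, 0)%N L k).2).
have phi_lin : linear phi.
  by move=> c A B; apply/rowP => k; rewrite !mxE.
have phi0 A : phi A = 0 -> A \in (0 : {vspace so_lie K 5})%VS.
  move=> /rowP AL; have := subvsP A; rewrite isom_spaceE mulmx1 mul1mx addr_eq0 => /eqP skew.
  have lt0 (i j : 'I_5) : (i < j)%N -> (vsval A : 'M[K]_5) i j = 0.
    move=> ij; have ijL : (val i, val j) \in L.
      by case: i j ij => [[|[|[|[|[|i]]]]] hi] [[|[|[|[|[|j]]]]] hj].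
    have ltL : (index (val i, val j) L < 10)%N by rewrite (index_mem _ L).
    by have := AL (Ordinal ltL); rewrite !mxE /= nth_index //= !inord_val.
  have sk i j : (vsval A : 'M[K]_5) i j = - (vsval A : 'M[K]_5) j i.
    by have /matrixP /(_ j i) := skew; rewrite !mxE.
  rewrite memv0; apply/eqP/val_inj/matrixP => i j; rewrite [RHS]mxE.
  case: (ltngtP i j) => [/lt0 //|/lt0 ji|/val_inj ->]; first by rewrite sk ji oppr0.
  by apply/eqP; have /eqP := sk j j; rewrite -addr_eq0 -mulr2n mulrn_eq0.
have := dim_leq_ker phi_lin (fun A => memvf (phi A)) phi0.
by rewrite dimv0 addn0 => /leq_trans; apply; rewrite dimvf.
Qed.

Let Jsp n : 'M[K]_(n + n) := block_mx 0 1%:M (- 1%:M) 0.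

Let Jsp_tr n : (Jsp n)^T = -1 *: Jsp n.
Proof.
rewrite scaleN1r /Jsp tr_block_mx !trmx0 linearN /= !trmx1 opp_block_mx.
by rewrite !oppr0 opprK.
Qed.

Let Jsp_unit n : Jsp n \in unitmx.
Proof.
have : Jsp n *m - Jsp n = 1%:M.
  rewrite mulmxN mulmx_block !mul0mx !mulmx0 !mul1mx !mulmx1 !addr0 !add0r.
  by rewrite opp_block_mx !oppr0 opprK -scalar_mx_block.
by case/mulmx1_unit.
Qed.

Lemma sp_form_invariant (n : nat) :
  @invariant_form K (sp_lie K n) (@trace_form K (n + n) (isom_space (Jsp n))).
Proof.
by apply: (@isom_form_invariant _ _ _ (-1)); rewrite ?Jsp_tr ?Jsp_unit // mulrNN mulr1.
Qed.

Lemma sp_ad_rank (n : nat) : (3 <= n)%N -> ad_rank_ge5 (sp_lie K n).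
Proof.
move=> n3; apply: sub_ad_rank => X W XU X0 XW.
have [|_ /(_ erefl) dimW] := @isom_ad_rank K _ _ (-1) (Jsp_tr n) _ (Jsp_unit n) X W XU X0 XW.
  by rewrite mulrNN mulr1.
by move: (\dim W) n3 dimW => w; lia.
Qed.

Lemma sp_nontrivial (n : nat) : (1 <= n)%N -> exists x : sp_lie K n, x != 0.
Proof.
case: n => // n _; pose A : 'M[K]_(n.+1 + n.+1) := block_mx 0 1%:M 0 0.
have Asp : A \in isom_space (Jsp n.+1).
  rewrite isom_spaceE tr_block_mx !trmx0 trmx1 !mulmx_block.
  rewrite !mul0mx !mulmx0 !mulmx1 !addr0 add_block_mx.
  by rewrite !addr0 subrr block_mx0.
exists (Subvs Asp); apply/eqP => /(congr1 val) /matrixP /(_ (lshift _ 0) (rshift _ 0)).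
by rewrite [LHS]block_mxEur !mxE eqxx => /eqP; rewrite oner_eq0.
Qed.

End ClassicalAlgebras.

(** * Application to real nilradicals and the classification *)

Section RealNilradical.
Variables (R : realType) (g : lieAlg R[i]) (n : lieAlg R) (s : nat).
Hypothesis n_nil : is_real_nilradical g n.
Local Notation a := (dsum_lie (abelian_lie R s) n).

Lemma small_symplectic (B : g -> g -> R[i]^o) : invariant_form B ->
  (\dim {:g} <= 10)%N -> ~~ odd (\dim {:a}) -> has_symplectic a.
Proof.
move=> B_inv; have [h [D [X [c [x [h_cartan D_pos X_span X_br [x_basis x_br]]]]]]] := n_nil.
exact: (@nilradical_sum_symplectic R R[i] (real_complex R) g h D X c n x B s).
Qed.

Lemma large_not_symplectic (g' : lieAlg R[i]) (B : g' -> g' -> R[i]^o) (y : g') :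
  lie_iso g g' -> invariant_form B -> ad_rank_ge5 g' -> y != 0 -> ~ has_symplectic a.
Proof.
move=> iso /(lie_iso_form iso) [B1 B_inv] /(lie_iso_ad_rank iso) rk.
move=> /(lie_iso_nontrivial iso) [y1 y0].
have [h [D [X [c [x [h_cartan D_pos X_span X_br [x_basis x_br]]]]]]] := n_nil.
exact: (@nilradical_sum_not_symplectic R R[i] (real_complex R) g h D X c n x B1 s _ _ _ _ _ _ _ _ y1).
Qed.

End RealNilradical.

Theorem theorem4p2 (R : realType) (g : lieAlg R[i]) (n : lieAlg R) (s : nat) :
  classical_simple g ->
  is_real_nilradical g n ->
  ~~ odd (\dim {: dsum_lie (abelian_lie R s) n}) ->
  has_symplectic (dsum_lie (abelian_lie R s) n) <->
  [\/ lie_iso g (sl_lie R[i] 2), lie_iso g (sl_lie R[i] 3)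
    | lie_iso g (so_lie R[i] 5)].
Proof.
move=> g_classical n_nil even_dim; split=> [sympl|].
  case: g_classical => -[m m_ge iso].
  - case: m m_ge iso => [|[|[|m]]] // _ iso; [by apply: Or31 | by apply: Or32|].
    have [y y0] := @sl_nontrivial R[i] m.+3 isT.
    by have [] := large_not_symplectic n_nil iso (sl_form_invariant _ _) (sl_ad_rank _) y0 sympl.
  - case: m m_ge iso => [|[|[|m]]] // _ iso; first by apply: Or33.
    have [|y y0] := @so_nontrivial R[i] (2 * m.+3).+1; first by lia.
    by have [] := large_not_symplectic n_nil iso (so_form_invariant _ _) (so_ad_rank _) y0 sympl; lia.
  - have [|y y0] := @sp_nontrivial R[i] m; first by lia.
    by have [] := large_not_symplectic n_nil iso (sp_form_invariant _ _) (sp_ad_rank m_ge) y0 sympl.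
  - have [|y y0] := @so_nontrivial R[i] (2 * m); first by lia.
    by have [] := large_not_symplectic n_nil iso (so_form_invariant _ _) (so_ad_rank _) y0 sympl; lia.
have small (g' : lieAlg R[i]) (B : g' -> g' -> R[i]^o) : lie_iso g g' -> invariant_form B ->
    (\dim {:g'} <= 10)%N -> has_symplectic (dsum_lie (abelian_lie R s) n).
  move=> iso /(lie_iso_form iso) [B1 B_inv] dim10; apply: small_symplectic B_inv _ even_dim => //.
  exact: leq_trans (lie_iso_dim iso) dim10.
(* The dimension bounds used for the three algebras are 4, 9 and 10. *)
case=> iso; apply: small iso _ _.
- exact: sl_form_invariant.
- exact: leq_trans (sl_dim _ _) _.
- exact: sl_form_invariant.
- exact: leq_trans (sl_dim _ _) _.
- exact: so_form_invariant.
- exact: so5_dim.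
Qed.
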